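(* Let $H_1$ and $H_2$ be selfadjoint relations in a separable Hilbert space $\mathfrak H$ which are bounded from below. Let $\mathsf i(H_j)=\{\mathsf i_j^+,\mathsf i_j^-,\mathsf i_j^0,\mathsf i_j^\infty\}$ be the inertia of $H_j$, $j=1,2$. Assume that $\mathsf i_1^-<\infty$ and that $H_1\le H_2$. Then $$H_2^{-1}\le H_1^{-1}\quad\text{if and only if}\quad \mathsf i_1^-=\mathsf i_2^- .$$
   Context: A (linear) relation $H$ in a Hilbert space $\mathfrak H$ is a linear subspace of $\mathfrak H\times\mathfrak H$. Put $\operatorname{dom}H=\{h:\{h,k\}\in H\}$, $\operatorname{ran}H=\{k:\{h,k\}\in H\}$, $\ker H=\{h:\{h,0\}\in H\}$, $\operatorname{mul}H=\{k:\{0,k\}\in H\}$. Further $H^{-1}=\{\{k,h\}:\{h,k\}\in H\}$, $H-\lambda=\{\{h,k-\lambda h\}:\{h,k\}\in H\}$, and $H^*=\{\{h,k\}:(g,h)=(f,k)\text{ for all }\{f,g\}\in H\}$; $H$ is selfadjoint if $H=H^*$. A selfadjoint relation $H$ decomposes orthogonally as $H=H_s\,\widehat\oplus\,(\{0\}\times\operatorname{mul}H)$ with respect to $\mathfrak H=\overline{\operatorname{dom}}H\oplus\operatorname{mul}H$, where $H_s=H\cap(\overline{\operatorname{dom}}H\times\overline{\operatorname{dom}}H)$ (the operator part) is a selfadjoint operator in $\overline{\operatorname{dom}}H$. The spectral measure of $H$ is $E(\cdot)=E_s(\cdot)\oplus 0_{\operatorname{mul}H}$, where $E_s$ is the spectral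 measure of $H_s$ on $\mathbb R$. $H$ is bounded from below by $m\in\mathbb R$ if $(H_sh,h)\ge m(h,h)$ for all $h\in\operatorname{dom}H$; the supremum of all such $m$ is the lower bound of $H$. Ordering: for selfadjoint relations $H_1,H_2$ with lower bounds $m_1,m_2$, $H_1\le H_2$ means that for some fixed $x<\min\{m_1,m_2\}$ (equivalently, for all such $x$) $0\le((H_2-x)^{-1}h,h)\le((H_1-x)^{-1}h,h)$ for all $h\in\mathfrak H$ (these resolvents are bounded everywhere defined operators). Inertia (for separable $\mathfrak H$): $\mathsf i(H)=\{\mathsf i^+(H),\mathsf i^-(H),\mathsf i^0(H),\mathsf i^\infty(H)\}$, an ordered quadruplet with $\mathsf i^+(H)=\dim\operatorname{ran}E((0,\infty))$, $\mathsf i^-(H)=\dim\operatorname{ran}E((-\infty,0))$, $\mathsf i^0(H)=\dim\ker H$, $\mathsf i^\infty(H)=\dim\operatorname{mul}H$, each in $\{0,1,2,\dots\}\cup\{\infty\}$. Inverses are taken in the sense of relations. The conditions $H_1\le H_2$ and $\mathsf i_1^-<\infty$ imply $\mathsf i_2^-<\infty$, hence $H_1^{-1}$ and $H_2^{-1}$ are both bounded from below and the ordering makes sense. *)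

(* Defs.v *)
From HB Require Import structures.
From mathcomp Require Import all_boot all_order all_algebra sesquilinear.
From mathcomp Require Import complex.
From mathcomp Require Import all_classical all_reals all_analysis.
Set Implicit Arguments.
Unset Strict Implicit.
Unset Printing Implicit Defensive.
Import Order.TTheory GRing.Theory Num.Theory numFieldNormedType.Exports.
Local Open Scope classical_set_scope.
Local Open Scope ring_scope.
Local Open Scope complex_scope.

(* A complex Hilbert space is a complete normed space [V] over [R[i]] with an
   inner product inducing its norm; [{dot V for @Num.conj R[i]}] is linear in the first
   argument and conjugate linear in the second. *)
Definition norm_from_dot (R : realType) (V : completeNormedModType R[i])
    (ip : {dot V for @Num.conj R[i]}) : Prop :=
  forall h : V, ip h h = `|h| ^+ 2.

Definition separable_space (T : topologicalType) : Prop :=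
  exists S : set T, countable S /\ dense S.

Section Relations.
Variables (R : realType) (V : completeNormedModType R[i]).
Variable ip : {dot V for @Num.conj R[i]}.
Implicit Types (H : set (V * V)) (h k : V).

Definition linear_relation H : Prop :=
  H (0, 0) /\
  forall (a : R[i]) (f1 g1 f2 g2 : V), H (f1, g1) -> H (f2, g2) ->
    H (a *: f1 + f2, a *: g1 + g2).

Definition rdom H : set V := [set h | exists k, H (h, k)].
Definition rker H : set V := [set h | H (h, 0)].
Definition rmul H : set V := [set k | H (0, k)].

Definition rinv H : set (V * V) := [set (p.2, p.1) | p in H].
Definition rel_shift H (l : R[i]) : set (V * V) :=
  [set (p.1, p.2 - l *: p.1) | p in H].

Definition radj H : set (V * V) :=
  [set p | forall f g, H (f, g) -> ip g p.1 = ip f p.2].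

Definition selfadjoint H : Prop := linear_relation H /\ H = radj H.

Definition op_part H : set (V * V) :=
  H `&` (closure (rdom H) `*` closure (rdom H)).

Definition bounded_below_by H (m : R) : Prop :=
  forall h k, op_part H (h, k) -> m%:C * ip h h <= ip k h.

Definition bounded_below H : Prop := exists m : R, bounded_below_by H m.

(* Equal to [+oo] when [rdom H] is trivial. *)
Definition lower_bound H : \bar R :=
  ereal_sup [set m%:E | m in bounded_below_by H].

(* In [R[i]], [0 <= z] says that [z] is real and nonnegative. *)
Definition rle H1 H2 : Prop :=
  exists x : R,
    (x%:E < lower_bound H1)%E /\ (x%:E < lower_bound H2)%E /\
    forall h, exists k1 k2,
      rinv (rel_shift H1 x%:C) (h, k1) /\ rinv (rel_shift H2 x%:C) (h, k2) /\
      0 <= ip k2 h <= ip k1 h.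

(* The scalar measures [mu h] are [A |-> (E(A) h, h)]; that they are measures
   is the (weak) countable additivity of [E], equivalent to the strong one for
   orthogonal projections. [E] is unconstrained off the Borel sets. *)
Record projection_valued_measure (E : set R -> {linear V -> V})
    (mu : V -> {measure set (measurableTypeR R) -> \bar R}) : Prop := {
  pvm_idem : forall A : set (measurableTypeR R), measurable A ->
    forall h, E A (E A h) = E A h ;
  pvm_sym : forall A : set (measurableTypeR R), measurable A ->
    forall h k, ip (E A h) k = ip h (E A k) ;
  pvm_inter : forall A B : set (measurableTypeR R),
    measurable A -> measurable B ->
    forall h, E (A `&` B) h = E A (E B h) ;
  pvm_scalar : forall A : set (measurableTypeR R), measurable A ->
    forall h, mu h A = (complex.Re (ip (E A h) h))%:E }.

(* [E] is E_s (+) 0 with respect to clos(dom H) (+) mul H, and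
   [op_part H] is the integral of t dE_s(t): its domain consists of the [h]
   with finite second moment, and its quadratic form is the integral of
   t d(E(t)h, h), which determines the operator by polarization. *)
Definition spectral_measure H (E : set R -> {linear V -> V}) : Prop :=
  exists mu : V -> {measure set (measurableTypeR R) -> \bar R},
    [/\ projection_valued_measure E mu,
        forall h, closure (rdom H) h -> E setT h = h,
        forall h, rmul H h -> E setT h = 0,
        forall h, rdom H h <->
          closure (rdom H) h /\ (\int[mu h]_t (t ^+ 2)%:E < +oo)%E &
        forall h k, op_part H (h, k) -> ip k h = (\int[mu h]_t t)%:C].

Definition lin_indep (n : nat) (v : 'I_n -> V) : Prop :=
  forall c : 'I_n -> R[i], \sum_(i < n) c i *: v i = 0 -> forall i, c i = 0.

(* Dimension of a linear subspace in {0, 1, 2, ...} U {+oo}. *)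
Definition subspace_dim (S : set V) : \bar R :=
  ereal_sup [set n%:R%:E | n in [set n : nat | exists v : 'I_n -> V,
    (forall i, S (v i)) /\ lin_indep v]].

End Relations.

Record inertia_quad (R : realType) := InertiaQuad {
  inertia_pos : \bar R ;
  inertia_neg : \bar R ;
  inertia_zero : \bar R ;
  inertia_inf : \bar R }.

(* [i] is the inertia of [H]; the spectral measure of a selfadjoint [H] exists
   and is unique by the spectral theorem, so [i] is determined by [H]. *)
Definition has_inertia (R : realType) (V : completeNormedModType R[i])
    (ip : {dot V for @Num.conj R[i]}) (H : set (V * V)) (i : inertia_quad R) : Prop :=
  exists E : set R -> {linear V -> V}, spectral_measure ip H E /\
    i = InertiaQuad (subspace_dim (range (E `]0, +oo[%classic)))
                    (subspace_dim (range (E `]-oo, 0[%classic)))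
                    (subspace_dim (rker H))
                    (subspace_dim (rmul H)).

(* Main.v *)
(* The negative inertia of [H] is the largest dimension of a subspace of [H] on
   which the Hermitian form [{h,k} |-> (k,h)] is negative definite; this number
   is visibly invariant under [H |-> H^-1]. If [K = (H - x)^-1 >= 0], then it is
   also the negative index of the bounded form [I + x K], whence [H1 <= H2]
   forces [i2^- <= i1^-]. Applied to [H2^-1 <= H1^-1], this gives the equality.

   Conversely, for [y = - 1/eps] very negative, comparing the resolvents of the
   inverses at [y] amounts to comparing the inverses of [B_j = I + (x + eps) K_j].
   For [x < 0] one has [B1 <= B2] and both have negative index [i1^- = i2^-].
   If [B1 s1 = B2 s2 = F], then for all [w]
     [B1[s1 - s2 + w] <= (F,s1) - (F,s2) + B2[w]],
   so [(F,s1) < (F,s2)] would make [s1 - s2] together with a maximal negative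
   subspace of [B2] a negative subspace of [B1] that is too large. *)
Require Import Defs.
From mathcomp Require Import all_boot all_order all_algebra sesquilinear.
From mathcomp Require Import complex.
From mathcomp Require Import all_classical all_reals all_analysis.
From mathcomp Require Import measurable_realfun.
From mathcomp Require Import ring lra.
Import Order.TTheory GRing.Theory Num.Theory numFieldNormedType.Exports.
Local Open Scope classical_set_scope.
Local Open Scope ring_scope.
Local Open Scope complex_scope.

Set Implicit Arguments.
Unset Strict Implicit.
Unset Printing Implicit Defensive.

(** * Hermitian forms and negative families *)

Section ComplexParts.
Variable R : realType.
Implicit Types z w : R[i].

Lemma ReM z w : complex.Re (z * w) =
  complex.Re z * complex.Re w - complex.Im z * complex.Im w.
Proof. by case: z; case: w. Qed.

Lemma ImM z w : complex.Im (z * w) =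
  complex.Re z * complex.Im w + complex.Im z * complex.Re w.
Proof. by case: z; case: w => a b c d /=; rewrite addrC [d * a]mulrC. Qed.

Lemma ReD z w : complex.Re (z + w) = complex.Re z + complex.Re w.
Proof. by case: z; case: w. Qed.

Lemma ImD z w : complex.Im (z + w) = complex.Im z + complex.Im w.
Proof. by case: z; case: w. Qed.

Lemma ReN z : complex.Re (- z) = - complex.Re z.
Proof. by case: z. Qed.

Lemma ImN z : complex.Im (- z) = - complex.Im z.
Proof. by case: z. Qed.

Lemma Re_conj z : complex.Re (Num.conj z) = complex.Re z.
Proof. by case: z. Qed.

Lemma Im_conj z : complex.Im (Num.conj z) = - complex.Im z.
Proof. by case: z. Qed.

Lemma conj_real (a : R) : Num.conj (a%:C) = a%:C.
Proof. by rewrite conj_Creal// complex_real. Qed.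

Lemma Re_sum n (F : 'I_n -> R[i]) :
  complex.Re (\sum_(i < n) F i) = \sum_(i < n) complex.Re (F i).
Proof. by apply: (big_morph (@complex.Re R)) => //; exact: ReD. Qed.

Definition sqnormc z : R := complex.Re z ^+ 2 + complex.Im z ^+ 2.

Lemma sqnormc_ge0 z : 0 <= sqnormc z.
Proof. by rewrite addr_ge0 ?sqr_ge0. Qed.

Lemma sqnormc_gt0 z : z != 0 -> 0 < sqnormc z.
Proof.
move=> z0; rewrite lt_neqAle sqnormc_ge0 andbT eq_sym; apply: contra z0.
by rewrite paddr_eq0 ?sqr_ge0// !sqrf_eq0 -(eq_complex z 0).
Qed.

Lemma mul_conj z : z * Num.conj z = (sqnormc z)%:C.
Proof. by rewrite -normCK -add_Re2_Im2. Qed.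

End ComplexParts.

Definition ReE := (ReM, ImM, ReD, ImD, ReN, ImN, Re_conj, Im_conj).

(** With more rows than columns the matrix has a nonzero vector in its left kernel. This later
    yields a nonzero combination of [n] vectors that is orthogonal to [m < n] given ones. *)
Lemma underdetermined_solution (F : fieldType) (n m : nat)
    (A : 'I_n -> 'I_m -> F) : (m < n)%N ->
  exists c : 'I_n -> F, (exists i, c i != 0) /\
    forall j, \sum_(i < n) c i * A i j = 0.
Proof.
move=> mn; pose M := \matrix_(i < n, j < m) A i j.
have : kermx M != 0.
  rewrite kermx_eq0 -row_leq_rank -ltnNge.
  exact: leq_ltn_trans (rank_leq_col _) mn.
case/rowV0Pn => v /sub_kermxP vM v0.
exists (v 0); split; first exact/rV0Pn.
move=> j; move/matrixP: vM => /(_ 0 j); rewrite !mxE => vMj.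
by rewrite -[RHS]vMj; apply: eq_bigr => i _; rewrite !mxE.
Qed.

Definition ord_cons (T : Type) (n : nat) (x : T) (f : 'I_n -> T) (i : 'I_n.+1) : T :=
  oapp f x (unlift ord0 i).

Lemma ord_cons0 T n (x : T) (f : 'I_n -> T) : ord_cons x f ord0 = x.
Proof. by rewrite /ord_cons unlift_none. Qed.

Lemma ord_consS T n (x : T) (f : 'I_n -> T) i : ord_cons x f (lift ord0 i) = f i.
Proof. by rewrite /ord_cons liftK. Qed.

(** * Sesquilinear forms on a complex vector space *)

Section Forms.
Variables (R : realType) (X : lmodType R[i]).
Local Notation C := R[i].
Implicit Types (B D : X -> X -> C) (S : set X).

Definition sesquilinear_form B : Prop :=
  (forall (a : C) u v w, B (a *: u + v) w = a * B u w + B v w) /\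
  (forall (a : C) u v w, B w (a *: u + v) = Num.conj a * B w u + B w v).

(** Relative to a set, since the form [{h,k} |-> (k,h)] of a selfadjoint relation is hermitian on
    the relation, but in general not on the whole product space. *)
Definition hermitian_on S B : Prop :=
  forall u v, S u -> S v -> B v u = Num.conj (B u v).

Definition linear_set S : Prop :=
  S 0 /\ forall (a : C) u v, S u -> S v -> S (a *: u + v).

(* Real parts are taken so that inequalities live in [R]; [B u u] is real
   whenever [B] is hermitian. *)
Definition negative_family B S (n : nat) (v : 'I_n -> X) : Prop :=
  (forall i, S (v i)) /\
  forall c : 'I_n -> C, (exists i, c i != 0) ->
    complex.Re (B (\sum_(i < n) c i *: v i) (\sum_(i < n) c i *: v i)) < 0.

(** The negative index enters only through its lower bounds [n], so an infinite index needs no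
    separate treatment. Index exactly [n] reads: true for [n], false for [n.+1]. *)
Definition negative_dim_ge B S n : Prop :=
  exists v : 'I_n -> X, negative_family B S v.

Definition neg_orthonormal B S (n : nat) (e : 'I_n -> X) : Prop :=
  (forall i, S (e i)) /\ forall i j, B (e i) (e j) = - (i == j)%:R.

Lemma linear_setT : linear_set [set: X].
Proof. by []. Qed.

Lemma linear_set_sum S n (c : 'I_n -> C) (v : 'I_n -> X) : linear_set S ->
  (forall i, S (v i)) -> S (\sum_(i < n) c i *: v i).
Proof.
move=> [S0 Sl] Sv; elim/big_ind: _ => // [x y Sx Sy|i _].
  by rewrite -[x]scale1r; exact: Sl.
by rewrite -[_ *: _]addr0; exact: Sl.
Qed.

Section SesquilinearForm.
Variable B : X -> X -> C.
Hypothesis sB : sesquilinear_form B.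

Lemma form0l w : B 0 w = 0.
Proof.
have := sB.1 1 0 0 w; rewrite scaler0 add0r mul1r => /eqP.
by rewrite -subr_eq0 opprD addrA subrr sub0r oppr_eq0 => /eqP.
Qed.

Lemma form0r w : B w 0 = 0.
Proof.
have := sB.2 1 0 0 w; rewrite scaler0 add0r rmorph1 mul1r => /eqP.
by rewrite -subr_eq0 opprD addrA subrr sub0r oppr_eq0 => /eqP.
Qed.

Lemma formDl u v w : B (u + v) w = B u w + B v w.
Proof. by have := sB.1 1 u v w; rewrite scale1r mul1r. Qed.

Lemma formDr u v w : B w (u + v) = B w u + B w v.
Proof. by have := sB.2 1 u v w; rewrite scale1r rmorph1 mul1r. Qed.

Lemma formZl a u w : B (a *: u) w = a * B u w.
Proof. by have := sB.1 a u 0 w; rewrite !addr0 form0l addr0. Qed.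

Lemma formZr a u w : B w (a *: u) = Num.conj a * B w u.
Proof. by have := sB.2 a u 0 w; rewrite !addr0 form0r addr0. Qed.

Lemma formNl u w : B (- u) w = - B u w.
Proof. by rewrite -scaleN1r formZl mulN1r. Qed.

Lemma formNr u w : B w (- u) = - B w u.
Proof. by rewrite -scaleN1r formZr rmorphN1 mulN1r. Qed.

Definition formE := (formDl, formDr, formNl, formNr, formZl, formZr).

Lemma form_suml n (c : 'I_n -> C) v w :
  B (\sum_(i < n) c i *: v i) w = \sum_(i < n) c i * B (v i) w.
Proof.
rewrite (big_morph (B^~ w) (fun x y => formDl x y w) (form0l w)).
by apply: eq_bigr => i _; rewrite formZl.
Qed.

Lemma form_sumr n (c : 'I_n -> C) v w :
  B w (\sum_(i < n) c i *: v i) = \sum_(i < n) Num.conj (c i) * B w (v i).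
Proof.
rewrite (big_morph (B w) (fun x y => formDr x y w) (form0r w)).
by apply: eq_bigr => i _; rewrite formZr.
Qed.

Lemma form_scale_diag a u : complex.Re (B (a *: u) (a *: u)) =
  sqnormc a * complex.Re (B u u).
Proof.
by rewrite formZl formZr mulrA mul_conj ReM /= mul0r subr0.
Qed.

End SesquilinearForm.

(** * Negative families: extension, maximality, stability *)

Section NegativeFamilies.
Variables (B : X -> X -> C) (S : set X).
Hypotheses (sB : sesquilinear_form B) (hB : hermitian_on S B).
Hypothesis lS : linear_set S.

(** A combination with nonzero coefficient at [w] is a scalar multiple of some [w + z] with [z] in
    the span of [v], and scaling preserves the sign of the form. *)
Lemma negative_family_lift n (v : 'I_n -> X) w :
  S w -> negative_family B S v ->
  (forall z, (exists c, z = \sum_(i < n) c i *: v i) ->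
     complex.Re (B (w + z) (w + z)) < 0) ->
  negative_dim_ge B S n.+1.
Proof.
move=> Sw [Sv nv] nw; exists (ord_cons w v); split.
  by move=> i; case: (unliftP ord0 i) => [j|] ->; rewrite ?ord_consS ?ord_cons0.
move=> c [i ci].
rewrite big_ord_recl ord_cons0.
under eq_bigr do rewrite ord_consS.
have [c0|c0] := eqVneq (c ord0) 0.
  rewrite c0 scale0r add0r; apply: nv.
  by case: (unliftP ord0 i) ci => [j ->|->]; [exists j|rewrite c0 eqxx].
set z := \sum_(i < n) _.
have -> : c ord0 *: w + z = c ord0 *: (w + (c ord0)^-1 *: z).
  by rewrite scalerDr scalerA divff// scale1r.
rewrite form_scale_diag// pmulr_rlt0 ?sqnormc_gt0//; apply: nw.
exists (fun i => (c ord0)^-1 * c (lift ord0 i)); rewrite scaler_sumr.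
by under eq_bigr do rewrite scalerA.
Qed.

Lemma neg_orthonormal_comb n (e : 'I_n -> X) (c : 'I_n -> C) :
  neg_orthonormal B S e ->
  complex.Re (B (\sum_(i < n) c i *: e i) (\sum_(i < n) c i *: e i)) =
  - \sum_(i < n) sqnormc (c i).
Proof.
move=> [_ eo]; rewrite form_suml// Re_sum -sumrN; apply: eq_bigr => i _.
rewrite form_sumr// (bigD1 i)//= eo eqxx big1 ?addr0.
  by rewrite mulrN1 mulrN mul_conj ReN.
by move=> j ji; rewrite eo eq_sym (negPf ji) oppr0 mulr0.
Qed.

Lemma neg_orthonormal_negative n (e : 'I_n -> X) :
  neg_orthonormal B S e -> negative_family B S e.
Proof.
move=> eo; split=> [|c [i ci]]; first exact: eo.1.
rewrite neg_orthonormal_comb// oppr_lt0 (bigD1 i)//=.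
by rewrite ltr_wpDr ?sqnormc_gt0// sumr_ge0// => j _; exact: sqnormc_ge0.
Qed.

Lemma hermitian_diag_real u : S u -> B u u = (complex.Re (B u u))%:C.
Proof.
move=> Su; apply/eqP; rewrite eq_complex /= eqxx /=.
have /(congr1 (@complex.Im R)) := hB Su Su; rewrite Im_conj => /eqP.
by rewrite -subr_eq0 opprK -mulr2n mulrn_eq0.
Qed.

Lemma neg_orthonormal_extend n (e : 'I_n -> X) w :
  neg_orthonormal B S e -> S w -> (forall j, B w (e j) = 0) ->
  complex.Re (B w w) < 0 ->
  exists e' : 'I_n.+1 -> X, neg_orthonormal B S e'.
Proof.
move=> [Se eo] Sw we wn.
pose t := (Num.sqrt (- complex.Re (B w w)))^-1.
have ew j : B (e j) w = 0 by rewrite (hB Sw)// we rmorph0.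
have nw : B (t%:C *: w) (t%:C *: w) = -1.
  rewrite formZl// formZr// conj_real hermitian_diag_real//.
  rewrite -!rmorphM/= mulrA -expr2 exprVn sqr_sqrtr ?oppr_ge0 ?ltW//.
  by rewrite invrN mulNr mulVf ?lt_eqF// rmorphN1.
have Stw : S (t%:C *: w) by rewrite -[_ *: _]addr0; apply: lS.2 => //; exact: lS.1.
exists (ord_cons (t%:C *: w) e); split.
  by move=> i; case: (unliftP ord0 i) => [j|] ->; rewrite ?ord_consS ?ord_cons0.
move=> i j; case: (unliftP ord0 i) => [i'|] ->; case: (unliftP ord0 j) => [j'|] ->;
  rewrite ?ord_consS ?ord_cons0.
- by rewrite eo (inj_eq lift_inj).
- by rewrite formZr// ew mulr0 eq_sym (negPf (neq_lift _ _)) oppr0.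
- by rewrite formZl// we mulr0 (negPf (neq_lift _ _)) oppr0.
- by rewrite nw eqxx.
Qed.

(* As long as [e] has fewer vectors than the negative family [v], some nonzero
   combination of [v] is orthogonal to [e] and can be normalized to extend it. *)
Lemma neg_orthonormal_exists n : negative_dim_ge B S n ->
  exists e : 'I_n -> X, neg_orthonormal B S e.
Proof.
move=> [v [Sv nv]].
suff H m : (m <= n)%N -> exists e : 'I_m -> X, neg_orthonormal B S e by exact: H.
elim: m => [_|m IH mn]; first by exists (fun=> 0); split=> - [].
have [e eo] := IH (ltnW mn).
have [c [cn0 ce]] := underdetermined_solution (fun i j => B (v i) (e j)) mn.
apply: (@neg_orthonormal_extend _ e (\sum_(i < n) c i *: v i)) => //.
- exact: linear_set_sum.
- by move=> j; rewrite form_suml.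
- exact: nv.
Qed.

(** With [s] the sum of the [B p (e i) *: e i], the vector [p + s] is orthogonal to every [e j]; the
    sign is plus because [B (e j) (e j) = -1]. Were the inequality false, [p + s] would be negative
    and would extend [e] beyond the maximal length. *)
Lemma neg_orthonormal_maximal n (e : 'I_n -> X) p :
  neg_orthonormal B S e -> ~ negative_dim_ge B S n.+1 -> S p ->
  - \sum_(i < n) sqnormc (B p (e i)) <= complex.Re (B p p).
Proof.
move=> eo nmax Sp; have [Se eE] := eo; rewrite leNgt; apply/negP => lt.
pose s := \sum_(i < n) B p (e i) *: e i.
have Ss : S s by exact: linear_set_sum.
have se j : B s (e j) = - B p (e j).
  rewrite form_suml// (bigD1 j)//= eE eqxx big1 ?addr0 ?mulrN1//.
  by move=> i ij; rewrite eE (negPf ij) oppr0 mulr0.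
have ps : complex.Re (B p s) = \sum_(i < n) sqnormc (B p (e i)).
  rewrite form_sumr// Re_sum; apply: eq_bigr => i _.
  by rewrite mulrC mul_conj.
have sp : complex.Re (B s p) = complex.Re (B p s) by rewrite (hB Sp)// Re_conj.
apply: nmax.
have Sps : S (p + s) by rewrite addrC -[s]scale1r; exact: lS.2.
have [|||e' /neg_orthonormal_negative] := @neg_orthonormal_extend _ e (p + s) eo.
- exact: Sps.
- by move=> j; rewrite formDl// se subrr.
- rewrite formDl// !formDr// !ReD sp ps neg_orthonormal_comb//.
  by rewrite subrr addr0 -[X in _ + X]opprK subr_lt0.
- by exists e'.
Qed.

(** On a combination of [e] the form [B] equals [- N], with [N] the sum of the squared moduli of the
    coefficients, while [D] is at most [M * N]. Negativity thus persists as long as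
    [eps * (M + 1) < 1]. *)
Lemma neg_orthonormal_stable n (e : 'I_n -> X) (D : X -> X -> C) :
  sesquilinear_form D -> neg_orthonormal B S e ->
  exists2 a : R, 0 < a & forall eps : R, 0 <= eps -> eps < a ->
    negative_family (fun u v => B u v + eps%:C * D u v) S e.
Proof.
move=> sD eo.
pose m i j := `|complex.Re (D (e i) (e j))| + `|complex.Im (D (e i) (e j))|.
pose M := \sum_(i < n) \sum_(j < n) m i j.
have M0 : 0 <= M by do 2!(apply: sumr_ge0 => ? _); rewrite addr_ge0.
exists (M + 1)^-1; first by rewrite invr_gt0; lra.
move=> eps eps0 epsM; split=> [|c cn0]; first exact: eo.1.
set w := \sum_(i < n) _.
have := neg_orthonormal_negative eo.
case=> _ /(_ c cn0); rewrite (neg_orthonormal_comb c eo) => Nc.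
rewrite ReD (neg_orthonormal_comb c eo) ReM /= mul0r subr0.
set N := \sum_(i < n) _ in Nc *.
have N0 : 0 < N by lra.
have cN i : sqnormc (c i) <= N.
  by rewrite /N (bigD1 i)//= lerDl sumr_ge0// => j _; exact: sqnormc_ge0.
have DM : complex.Re (D w w) <= M * N.
  rewrite form_suml// Re_sum mulr_suml; apply: ler_sum => i _.
  rewrite form_sumr// mulr_sumr Re_sum mulr_suml; apply: ler_sum => j _.
  rewrite mulrA /m !ReE; move: (cN i) (cN j); rewrite /sqnormc.
  move: (complex.Re (c i)) (complex.Im (c i)) => a b.
  move: (complex.Re (c j)) (complex.Im (c j)) => a' b'.
  move: (complex.Re (D _ _)) (complex.Im (D _ _)) => x y h1 h2.
  (* The real and imaginary parts of [c i] times the conjugate of [c j] are bounded by the mean of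
     the two squared moduli, each at most [N]. *)
  have p1 : `|a * a' - b * - b'| <= N.
    have := sqr_ge0 (a - a'); have := sqr_ge0 (b - b').
    have := sqr_ge0 (a + a'); have := sqr_ge0 (b + b').
    by rewrite ler_norml; move=> *; apply/andP; split; lra.
  have p2 : `|a * - b' + b * a'| <= N.
    have := sqr_ge0 (b - a'); have := sqr_ge0 (a - b').
    have := sqr_ge0 (b + a'); have := sqr_ge0 (a + b').
    by rewrite ler_norml; move=> *; apply/andP; split; lra.
  apply: le_trans (ler_norm _) _; apply: le_trans (ler_normB _ _) _.
  by rewrite !normrM mulrDl lerD// mulrC ler_wpM2l.
have epsM1 : eps * (M + 1) < 1 by rewrite -ltr_pdivlMr ?div1r//; lra.
nra.
Qed.

End NegativeFamilies.

(** * Comparison of two forms *)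

Lemma negative_dim_ge_sub B D S n :
  (forall u, S u -> complex.Re (B u u) <= complex.Re (D u u)) -> linear_set S ->
  negative_dim_ge D S n -> negative_dim_ge B S n.
Proof.
move=> BD lS [v [Sv nv]]; exists v; split=> // c cn0.
by apply: le_lt_trans (nv c cn0); apply: BD; exact: linear_set_sum.
Qed.

Lemma negative_dim_ge0 B S : negative_dim_ge B S 0.
Proof. by exists (fun=> 0); split=> [[]//|c [[]//]]. Qed.

Lemma nonneg_negative_dim B S n : linear_set S ->
  (forall u, S u -> 0 <= complex.Re (B u u)) -> ~ negative_dim_ge B S n.+1.
Proof.
move=> lS B0 [v [Sv nv]].
have := nv (fun=> 1) (ex_intro _ ord0 (oner_neq0 _)).
by rewrite ltNge B0//; exact: linear_set_sum.
Qed.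

(* If the conclusion fails, [s1 - s2] enlarges the negative family of [B2] to
   one of [B1], because
   [B1[s1 - z] - B2[z - s2] <= B1[s1] - B2[s2]] for all [z]. *)
Lemma inverse_form_antitone B1 B2 n s1 s2 :
  sesquilinear_form B1 -> sesquilinear_form B2 ->
  hermitian_on setT B1 -> hermitian_on setT B2 ->
  (forall u, complex.Re (B1 u u) <= complex.Re (B2 u u)) ->
  (forall z, B1 s1 z = B2 s2 z) ->
  negative_dim_ge B2 setT n -> ~ negative_dim_ge B1 setT n.+1 ->
  complex.Re (B2 s2 s2) <= complex.Re (B1 s1 s1).
Proof.
move=> sB1 sB2 hB1 hB2 le12 eq12 [v nv] nmax; rewrite leNgt; apply/negP => lt.
apply: nmax; apply: (@negative_family_lift _ _ sB1 n v (s1 - s2)) => //.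
  split=> // c cn0; exact: le_lt_trans (le12 _) (nv.2 c cn0).
move=> w [c wE].
have w0 : complex.Re (B2 w w) <= 0.
  have [|/existsNP] := pselect (forall i, c i = 0) => [c0|[i /eqP ci]].
    by rewrite wE big1 ?form0l// => i _; rewrite c0 scale0r.
  by rewrite wE ltW//; apply: nv.2; exists i.
have [z zE] : exists z, w = s2 - z.
  by exists (s2 - w); rewrite opprB addrCA subrr addr0.
have -> : s1 - s2 + w = s1 - z by rewrite zE addrA subrK.
(* Both expansions have the same cross term, since [B1 s1 z = B2 s2 z]. *)
have B1E : complex.Re (B1 (s1 - z) (s1 - z)) = complex.Re (B1 s1 s1)
    - 2 * complex.Re (B2 s2 z) + complex.Re (B1 z z).
  rewrite formDl// formNl// !formDr// !formNr// !ReE.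
  by rewrite (hB1 s1 z)// Re_conj (eq12 z); ring.
have B2E : complex.Re (B2 w w) = complex.Re (B2 s2 s2)
    - 2 * complex.Re (B2 s2 z) + complex.Re (B2 z z).
  rewrite zE formDl// formNl// !formDr// !formNr// !ReE.
  by rewrite (hB2 s2 z)// Re_conj; ring.
by have := le12 z; lra.
Qed.

End Forms.

(** * Hilbert spaces *)

Section Hilbert.
Variables (R : realType) (V : completeNormedModType R[i]).
Variable ip : {dot V for @Num.conj R[i]}.
Hypothesis hip : norm_from_dot ip.
Local Notation C := R[i].
Implicit Types (u v w h k f g : V) (H G : set (V * V)) (M : set V).

Lemma ip_sesquilinear : sesquilinear_form ip.
Proof.
split=> a u v w; first by rewrite linearDl linearZl_LR.
by rewrite linearDr linearZr.
Qed.

Lemma ipC u v : ip v u = Num.conj (ip u v).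
Proof. by rewrite hermC expr0 mul1r. Qed.

Lemma ip_hermitian S : hermitian_on S ip.
Proof. by move=> u v _ _; exact: ipC. Qed.

(** The squared norm as an element of [R], so that estimates are accessible to real arithmetic. *)
Definition sqn v : R := complex.Re (ip v v).

Lemma ip_sqn v : ip v v = (sqn v)%:C.
Proof. exact: (hermitian_diag_real (@ip_hermitian setT)). Qed.

Lemma sqn_ge0 v : 0 <= sqn v.
Proof. by have := dnorm_ge0 ip v; rewrite ip_sqn ler0c. Qed.

Lemma sqn_eq0 v : sqn v = 0 -> v = 0.
Proof. by move=> v0; apply/eqP; rewrite -(dnorm_eq0 ip) ip_sqn v0. Qed.

Lemma sqn0 : sqn 0 = 0.
Proof. by rewrite /sqn (form0l ip_sesquilinear). Qed.

Let ipE := formE ip_sesquilinear.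

Lemma sqnD u v : sqn (u + v) = sqn u + 2 * complex.Re (ip u v) + sqn v.
Proof. by rewrite /sqn !ipE !ReE (ipC u v) !ReE; ring. Qed.

Lemma sqnN u : sqn (- u) = sqn u.
Proof. by rewrite /sqn !ipE opprK. Qed.

Lemma sqnZ a u : sqn (a *: u) = sqnormc a * sqn u.
Proof. exact: form_scale_diag ip_sesquilinear _ _. Qed.

Lemma sqnB u v : sqn (u - v) = sqn u - 2 * complex.Re (ip u v) + sqn v.
Proof. by rewrite sqnD sqnN !ipE !ReE; ring. Qed.

Lemma sqnBC u v : sqn (u - v) = sqn (v - u).
Proof. by rewrite -sqnN opprB. Qed.

Lemma parallelogram u v : sqn (u + v) + sqn (u - v) = 2 * sqn u + 2 * sqn v.
Proof. by rewrite sqnD sqnB; ring. Qed.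

Lemma sqnD_le u v : sqn (u + v) <= 2 * sqn u + 2 * sqn v.
Proof. by rewrite -parallelogram lerDl sqn_ge0. Qed.

Lemma cauchy_schwarz u v : sqnormc (ip u v) <= sqn u * sqn v.
Proof.
have [/sqn_eq0 ->|v0] := eqVneq (sqn v) 0.
  by rewrite sqn0 mulr0 (form0r ip_sesquilinear) /sqnormc expr0n/= addr0.
have {}v0 : 0 < sqn v by rewrite lt_neqAle eq_sym v0 sqn_ge0.
(* The squared norm of this vector is [sqn v] times the difference of the two sides. *)
have := sqn_ge0 ((sqn v)%:C *: u - ip u v *: v).
rewrite sqnB !sqnZ !ipE !ReE /sqnormc /=.
move: (complex.Re (ip u v)) (complex.Im (ip u v)) => a b h.
rewrite -subr_ge0 -(pmulr_rge0 _ v0); lra.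
Qed.

Lemma norm_lt_sqn v (e : R) : 0 < e -> (`|v| < e%:C) = (sqn v < e ^+ 2).
Proof.
move=> e0; have -> : `|v| = (complex.Re `|v|)%:C by rewrite RRe_real// normr_real.
have [iv nv] : complex.Im `|v| = 0 /\ 0 <= complex.Re `|v|.
  by have := normr_ge0 v; rewrite lecE => /andP[/eqP].
have -> : sqn v = complex.Re `|v| ^+ 2 by rewrite /sqn hip !expr2 ReM iv mulr0 subr0.
by rewrite ltcR ltr_pXn2r ?nnegrE ?(ltW e0).
Qed.

Lemma complex_gt0P (e : C) : 0 < e -> exists2 a : R, 0 < a & e = a%:C.
Proof.
case: e => a b; rewrite ltcE/= => /andP[/eqP -> a0].
by exists a.
Qed.

Lemma closureP (A : set V) p :
  closure A p <-> forall e : R, 0 < e -> exists2 m, A m & sqn (p - m) < e.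
Proof.
split=> [cA e e0|cA B /nbhs_ballP[e /complex_gt0P[a a0 ->] eB]].
  have se0 : 0 < Num.sqrt e by rewrite sqrtr_gt0.
  have /cA[m [Am]] := nbhsx_ballx p (Num.sqrt e)%:C ltac:(by rewrite ltcR).
  rewrite -ball_normE /ball_/= norm_lt_sqn// sqr_sqrtr ?ltW// => ?.
  by exists m.
have [m Am pm] := cA (a ^+ 2) (exprn_gt0 _ a0).
exists m; split=> //; apply: eB.
by rewrite -ball_normE /ball_/= norm_lt_sqn.
Qed.

Lemma harmonic_lt (e : R) : 0 < e ->
  exists N, forall n, (N <= n)%N -> n.+1%:R^-1 < e.
Proof.
move=> e0; have [N _ NP] := near_infty_natSinv_lt (PosNum e0).
by exists N => n Nn; exact: NP.
Qed.

(** Completeness in the form needed for sequences whose terms are chosen with error [1/(n+1)]: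
    minimizing sequences and preimages under [G - y]. *)
Lemma cvg_of_rate (a : nat -> V) (c : R) :
  (forall n j : nat, sqn (a n - a j) <= c * (n.+1%:R^-1 + j.+1%:R^-1)) ->
  exists l, forall e : R, 0 < e ->
    exists N, forall n, (N <= n)%N -> sqn (a n - l) < e.
Proof.
move=> ac; have c0 : 0 <= c.
  have := ac 0%N 0%N; rewrite subrr sqn0 pmulr_lge0// addr_gt0//; exact: invr_gt0.
have : cvg (a @ \oo).
  apply: cauchy_cvg; apply/cauchy_exP => e /complex_gt0P[b b0 ->].
  have d0 : 0 < b ^+ 2 / (2 * (c + 1)) by rewrite divr_gt0 ?exprn_gt0//; lra.
  have [N NP] := harmonic_lt d0.
  exists (a N); exists N => // n /= Nn.
  rewrite -ball_normE /ball_/= norm_lt_sqn//.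
  apply: le_lt_trans (ac _ _) _.
  have := NP _ (leqnn N); have := NP _ Nn.
  rewrite !ltr_pdivlMr; try lra.
  have : 0 < n.+1%:R^-1 :> R by rewrite invr_gt0.
  have : 0 < N.+1%:R^-1 :> R by rewrite invr_gt0.
  move: (n.+1%:R^-1) (N.+1%:R^-1) => x y *; lra.
case/cvg_ex => l /cvgrPdist_lt al; exists l => e e0.
have se0 : 0 < Num.sqrt e by rewrite sqrtr_gt0.
have [N _ NP] := al (Num.sqrt e)%:C ltac:(by rewrite ltcR).
exists N => n /NP; rewrite norm_lt_sqn// sqr_sqrtr ?ltW//.
by rewrite sqnBC.
Qed.

Lemma le0_of_lt_eps (a c : R) : 0 <= c -> (forall e, 0 < e -> a <= c * e) -> a <= 0.
Proof.
move=> c0 ac; rewrite leNgt; apply/negP => a0.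
have := ac (a / (2 * (c + 1))) ltac:(rewrite divr_gt0//; lra).
rewrite mulrA ler_pdivlMr; [nra|lra].
Qed.

Lemma linear_setB S u v : linear_set S -> S u -> S v -> S (u - v).
Proof. by move=> lS Su Sv; rewrite addrC -scaleN1r; exact: lS.2. Qed.

Lemma closure_linear M : linear_set M -> linear_set (closure M).
Proof.
move=> lM; split=> [|a u v /closureP cu /closureP cv].
  exact/subset_closure/lM.1.
apply/closureP => e e0.
(* The error of [a *: m + n] is at most [(2 * sqnormc a + 2) * e / c], which is below [e]. *)
pose c := 2 * sqnormc a + 3.
have c0 : 0 < c by rewrite /c; have := sqnormc_ge0 a; lra.
have [m Mm mu] := cu (e / c) (divr_gt0 e0 c0).
have [n Mn nv] := cv (e / c) (divr_gt0 e0 c0).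
exists (a *: m + n); first exact: lM.2.
rewrite opprD addrACA -scalerBr; apply: le_lt_trans (sqnD_le _ _) _.
rewrite sqnZ; move: mu nv; rewrite !ltr_pdivlMr//.
move: (sqn _) (sqn _) (sqn_ge0 (u - m)) (sqn_ge0 (v - n)) (sqnormc_ge0 a).
rewrite /c => x y; nra.
Qed.

(** The parallelogram law makes a minimizing sequence for the distance from [v] to [M] Cauchy. Its
    limit [p] attains the distance, and minimality forces [v - p] to be orthogonal to [M]. *)
Lemma orthogonal_projection M v : linear_set M -> closure M `<=` M ->
  exists2 p, M p & forall m, M m -> ip (v - p) m = 0.
Proof.
move=> lM cM.
pose E := [set sqn (v - m) | m in M].
pose d := inf E.
have dE m : M m -> d <= sqn (v - m).
  move=> Mm; apply: ge_inf; last by exists m.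
  by exists 0 => _ [u _ <-]; exact: sqn_ge0.
have hE : has_inf E.
  split; first by exists (sqn (v - 0)), 0 => //; exact: lM.1.
  by exists 0 => _ [u _ <-]; exact: sqn_ge0.
have /choice[a aP] n : exists m, M m /\ sqn (v - m) < d + n.+1%:R^-1.
  have [|_ [m Mm <-] dm] := @inf_adherent _ E n.+1%:R^-1 _ hE.
    by rewrite invr_gt0.
  by exists m.
have half : (2^-1 : C) = (2^-1 : R)%:C by rewrite rmorphV ?unitfE//= rmorph_nat.
(* The midpoint of [m] and [m'] lies in [M], hence has squared distance at least [d] from [v]. *)
have mid m m' : M m -> M m' ->
    sqn (m - m') <= 2 * (sqn (v - m) - d) + 2 * (sqn (v - m') - d).
  move=> Mm Mm'.
  have Mh : M (2^-1 *: (m + m')).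
    rewrite -[_ *: _]addr0; apply: lM.2 lM.1.
    by rewrite -[m]scale1r; exact: lM.2.
  have := parallelogram (v - m') (v - m); have := dE _ Mh.
  have -> : v - m' - (v - m) = m - m' by rewrite opprB addrC addrA subrK.
  have -> : v - m' + (v - m) = (2%:R : R)%:C *: (v - 2^-1 *: (m + m')).
    rewrite rmorph_nat scalerBr scalerA divff ?pnatr_eq0// scale1r.
    by rewrite scaler_nat mulr2n opprD addrACA [- m' - m]addrC.
  by rewrite sqnZ {1}/sqnormc /= expr0n addr0; lra.
have [|p pP] := @cvg_of_rate a 2.
  move=> n j; apply: le_trans (mid _ _ (aP n).1 (aP j).1) _.
  have := (aP n).2; have := (aP j).2.
  by move: (n.+1%:R^-1) (j.+1%:R^-1) => x y; lra.
have Mp : M p.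
  apply: cM; apply/closureP => e /pP[N /(_ N (leqnn _)) ?].
  by exists (a N); [exact: (aP N).1|rewrite sqnBC].
(* The parallelogram law is applied to [v - a n] and [a n - p]: their difference is
   [v - (2 a n - p)], and [2 a n - p] lies in [M], so its squared distance is at least [d]. *)
have dp : sqn (v - p) <= d.
  rewrite -subr_le0; apply: (@le0_of_lt_eps _ 4) => // e e0.
  have [N NP] := pP e e0; have [N' NP'] := harmonic_lt e0.
  pose n := maxn N N'.
  have := NP n (leq_maxl _ _); have := NP' n (leq_maxr _ _).
  have [Mn vn] := aP n.
  have := parallelogram (v - a n) (a n - p).
  have -> : v - a n + (a n - p) = v - p by rewrite addrA subrK.
  have -> : v - a n - (a n - p) = v - (2%:R *: a n - p).
    by rewrite scaler_nat mulr2n !opprB opprD !addrA [v - _ + p]addrAC.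
  have : M (2%:R *: a n - p).
    by apply: linear_setB => //; rewrite -[_ *: _]addr0; apply: lM.2 lM.1.
  by move/dE; move: (n.+1%:R^-1) vn => x; lra.
exists p => // m Mm; apply/eqP/negPn/negP => ip0.
have := sqnormc_gt0 ip0; set z := ip _ _ => z0.
have s0 := sqn_ge0 m.
(* Moving [p] by [t z m] changes the squared distance by [t |z|^2 (t |m|^2 - 2)]. This choice of [t]
   gives [t |m|^2 < 1], so the change is negative. *)
have [t t0 tE] : exists2 t : R, 0 < t & t * (1 + sqn m) = 1.
  by exists (1 + sqn m)^-1; rewrite ?invr_gt0 ?mulVf ?gt_eqF//; lra.
have : M (p + (t%:C * z) *: m) by rewrite addrC; exact: lM.2.
move/dE; rewrite opprD addrA sqnB sqnZ (formZr ip_sesquilinear) -/z !ReE.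
have -> : sqnormc (t%:C * z) = t ^+ 2 * sqnormc z.
  by rewrite /sqnormc !ReE/=; ring.
move: z0; rewrite /sqnormc /=.
move: (complex.Re z) (complex.Im z) => x y; set Z := x ^+ 2 + y ^+ 2 => Z0 h.
have tZ : 0 < t * Z by rewrite mulr_gt0.
have : 0 <= t * Z * (t * sqn m - 2) by move: h; rewrite /Z; lra.
by rewrite pmulr_rge0//; lra.
Qed.

End Hilbert.

(** * Selfadjoint relations *)

Section SelfadjointRelations.
Variables (R : realType) (V : completeNormedModType R[i]).
Variable ip : {dot V for @Num.conj R[i]}.
Hypothesis hip : norm_from_dot ip.
Local Notation C := R[i].
Local Notation sqn := (sqn ip).
Implicit Types (u v w h k f g : V) (H G : set (V * V)).

Let ipE := formE (ip_sesquilinear ip).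

Definition rel_form (p q : V * V) : C := ip p.2 q.1.

Lemma rel_form_sesquilinear : sesquilinear_form rel_form.
Proof. by split=> a [u u'] [v v'] [w w']; rewrite /rel_form/= !ipE. Qed.

Lemma selfadjoint_linear H : selfadjoint ip H -> linear_set H.
Proof. by case=> -[H0 HL] _; split=> // a [u u'] [v v']; exact: HL. Qed.

Lemma selfadjointP H h k : selfadjoint ip H ->
  (forall f g, H (f, g) -> ip g h = ip f k) -> H (h, k).
Proof. by case=> _ {2}-> hk f g /hk. Qed.

Lemma selfadjoint_sym H h k f g : selfadjoint ip H ->
  H (f, g) -> H (h, k) -> ip g h = ip f k.
Proof. by case=> _ HE Hfg; rewrite HE => /(_ f g Hfg). Qed.

Lemma selfadjoint_hermitian H : selfadjoint ip H -> hermitian_on H rel_form.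
Proof.
move=> sa [f g] [h k] Hfg Hhk; rewrite /rel_form/=.
by rewrite (selfadjoint_sym sa Hfg Hhk) -ipC.
Qed.

Lemma linear_relB H h k h' k' : linear_set H ->
  H (h, k) -> H (h', k') -> H (h - h', k - k').
Proof.
move=> lH Hhk Hhk'.
have -> : (h - h', k - k') = -1 *: (h', k') + (h, k).
  by rewrite [RHS]surjective_pairing /= !scaleN1r ![- _ + _]addrC.
exact: lH.2.
Qed.

Lemma rinvE H h k : rinv H (h, k) <-> H (k, h).
Proof. by split=> [[[a b] Hab [<- <-]]//|Hkh]; exists (k, h). Qed.

Lemma selfadjoint_rinv H : selfadjoint ip H -> selfadjoint ip (rinv H).
Proof.
move=> sa; have [H0 HL] := sa.1; split.
  split=> [|a f1 g1 f2 g2]; first exact/rinvE.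
  by move=> /rinvE h1 /rinvE h2; apply/rinvE; exact: HL.
apply/seteqP; split=> -[h k].
  move=> /rinvE Hkh f g /rinvE Hgf /=.
  by rewrite (selfadjoint_sym sa Hgf Hkh).
by move=> rk; apply/rinvE/(selfadjointP sa) => f g Hfg; rewrite (rk g f)//; exact/rinvE.
Qed.

Lemma resolventE H (x : C) h k :
  rinv (rel_shift H x) (h, k) <-> H (k, h + x *: k).
Proof.
split=> [/rinvE[[a b] Hab [<- <-]]|Hk]; first by rewrite subrK.
by apply/rinvE; exists (k, h + x *: k) => //=; rewrite addrK.
Qed.

(** As [H] is an adjoint, membership is a family of identities [(g,h) = (f,k)], and these pass to
    the limit by Cauchy-Schwarz. *)
Lemma selfadjoint_closed H h k : selfadjoint ip H ->
  (forall e : R, 0 < e ->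
    exists h' k', [/\ H (h', k'), sqn (h - h') < e & sqn (k - k') < e]) ->
  H (h, k).
Proof.
move=> sa ap; apply: (selfadjointP sa) => f g Hfg; apply/eqP; rewrite -subr_eq0.
apply/negPn/negP => /sqnormc_gt0; apply/negP; rewrite -leNgt.
apply: (@le0_of_lt_eps _ _ (2 * (sqn f + sqn g))).
  by rewrite mulr_ge0// addr_ge0// sqn_ge0.
move=> e e0; have [h' [k' [Hh' hh' kk']]] := ap e e0.
have -> : ip g h - ip f k = ip g (h - h') - ip f (k - k').
  by rewrite !ipE (selfadjoint_sym sa Hfg Hh'); ring.
have := cauchy_schwarz ip g (h - h'); have := cauchy_schwarz ip f (k - k').
have := sqn_ge0 ip f; have := sqn_ge0 ip g.
have := sqn_ge0 ip (h - h'); have := sqn_ge0 ip (k - k').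
rewrite /sqnormc !ReE.
have := sqr_ge0 (complex.Re (ip g (h - h')) + complex.Re (ip f (k - k'))).
have := sqr_ge0 (complex.Im (ip g (h - h')) + complex.Im (ip f (k - k'))).
move: hh' kk' (sqn f) (sqn g); move: (sqn (h - h')) (sqn (k - k')).
move=> s t se te a b.
move: (complex.Re _) (complex.Re _) (complex.Im _) (complex.Im _) => x1 x2 x3 x4.
move=> p1 p2 s0 t0 b0 a0 q1 q2.
have : a * s <= a * e by rewrite ler_wpM2l// ltW.
have : a * t <= a * e by rewrite ler_wpM2l// ltW.
have : b * s <= b * e by rewrite ler_wpM2l// ltW.
have : b * t <= b * e by rewrite ler_wpM2l// ltW.
lra.
Qed.

(** The lower bound makes [G - y] bounded below in norm, so its range [M] is closed. A vector [r]
    orthogonal to [M] satisfies [{r, y r}] in [G] by selfadjointness, and the lower bound [m > y]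
    then forces [r = 0]. *)
Lemma resolvent_surjective G (m y : R) : selfadjoint ip G ->
  (forall h k, G (h, k) -> m * sqn h <= complex.Re (ip k h)) -> y < m ->
  forall f, exists g, G (g, f + y%:C *: g).
Proof.
move=> sa lb ym; set c := m - y; have c0 : 0 < c by rewrite subr_gt0.
have [G0 GL] := selfadjoint_linear sa.
(* Expanding [sqn (k - y h - c h) >= 0] and inserting [Re (k - y h, h) >= c * sqn h]. *)
have coer h k : G (h, k) -> c ^+ 2 * sqn h <= sqn (k - y%:C *: h).
  move=> /lb; have := sqn_ge0 ip (k - y%:C *: h - c%:C *: h).
  rewrite sqnB sqnZ !ipE !ReE /sqnormc ip_sqn /= => h0 h1.
  have : 0 <= c * (complex.Re (ip k h) - m * sqn h).
    by rewrite mulr_ge0 ?(ltW c0)// subr_ge0.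
  by rewrite /c in h0 *; lra.
pose M := [set f | exists g, G (g, f + y%:C *: g)].
have lM : linear_set M.
  split; first by exists 0; rewrite scaler0 addr0.
  move=> a u v [g Gg] [g' Gg']; exists (a *: g + g').
  have -> : a *: u + v + y%:C *: (a *: g + g')
    = a *: (u + y%:C *: g) + (v + y%:C *: g').
    by rewrite !scalerDr addrACA !scalerA [y%:C * a]mulrC.
  exact: GL _ _ _ Gg Gg'.
have coerM u g : G (g, u + y%:C *: g) -> c ^+ 2 * sqn g <= sqn u.
  by move=> /coer; rewrite addrK.
have cM : closure M `<=` M.
  move=> f /(closureP hip) fM.
  have /choice[a /choice[b ab]] n : exists g, exists u,
      G (g, u + y%:C *: g) /\ sqn (f - u) < n.+1%:R^-1.
    have [|u [g Gg] fu] := fM n.+1%:R^-1; first by rewrite invr_gt0.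
    by exists g, u.
  have [|g gP] := @cvg_of_rate _ _ _ hip a (2 / c ^+ 2).
    move=> n j; rewrite mulrAC ler_pdivlMr ?exprn_gt0// mulrC.
    apply: le_trans (coerM (b n - b j) _ _) _.
      have -> : b n - b j + y%:C *: (a n - a j) =
          (b n + y%:C *: a n) - (b j + y%:C *: a j).
        by rewrite scalerBr opprD addrACA.
      exact: (linear_relB (selfadjoint_linear sa) (ab n).1 (ab j).1).
    have -> : b n - b j = (f - b j) - (f - b n).
      by rewrite opprB [RHS]addrC addrA subrK.
    apply: le_trans (sqnD_le _ _ _) _; rewrite sqnN mulrDr addrC.
    by apply: lerD; rewrite ler_pM2l// ltW// (ab _).2.
  exists g; apply: (selfadjoint_closed sa) => e e0.
  (* The second components differ by [(f - b n) + y (g - a n)], whose squared norm is at most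
     [(2 + 2 y^2) d < e]. *)
  pose d := e / (2 * y ^+ 2 + 3).
  have y0 := sqr_ge0 y.
  have d0 : 0 < d by rewrite divr_gt0//; lra.
  have dE : d * (2 * y ^+ 2 + 3) = e by rewrite divfK// gt_eqF//; lra.
  have [N NP] := gP _ d0; have [N' NP'] := harmonic_lt d0.
  pose n := maxn N N'; have := NP n (leq_maxl _ _).
  have := lt_trans (ab n).2 (NP' n (leq_maxr _ _)).
  rewrite (sqnBC _ (a n)) => fb ga.
  exists (a n), (b n + y%:C *: a n); split; first exact: (ab n).1.
    by apply: lt_le_trans ga _; rewrite -dE; nra.
  rewrite opprD addrACA -scalerBr; apply: le_lt_trans (sqnD_le _ _ _) _.
  rewrite sqnZ /sqnormc /= expr0n addr0 -dE; nra.
move=> f; have [q Mq qM] := orthogonal_projection hip f lM cM.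
suff r0 : f - q = 0 by rewrite -(subrK q f) r0 add0r.
move: (f - q) qM => r qM.
have /lb : G (r, y%:C *: r).
  apply: (selfadjointP sa) => h k Ghk.
  have : ip r (k - y%:C *: h) = 0 by apply: qM; exists h; rewrite subrK.
  rewrite !ipE conj_real => /eqP; rewrite subr_eq0 => /eqP rk.
  by rewrite (ipC _ r k) rk rmorphM/= conj_real -ipC.
rewrite !ipE ip_sqn ReM /= mul0r subr0 => rm.
apply: (@sqn_eq0 _ _ ip); apply/eqP; rewrite eq_le sqn_ge0 andbT.
by rewrite -(pmulr_rle0 _ c0) /c; lra.
Qed.

(** Project [k] onto the closure of the domain. A vector orthogonal to [rdom H] pairs with [0] to an
    element of the adjoint, so the remainder lies in [rmul H]. *)
Lemma dom_mul_decomposition H k : selfadjoint ip H -> exists p,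
  [/\ closure (rdom H) p, rmul H (k - p) &
      forall h, rdom H h -> ip (k - p) h = 0].
Proof.
move=> sa; have [H0 HL] := selfadjoint_linear sa.
have lD : linear_set (rdom H).
  split; first by exists 0.
  by move=> a u v [u' Hu] [v' Hv]; exists (a *: u' + v'); exact: HL _ _ _ Hu Hv.
have [p Dp kp] := orthogonal_projection hip k (closure_linear hip lD)
  (@closed_closure _ (rdom H)).
have {}kp h : rdom H h -> ip (k - p) h = 0.
  by move=> Dh; apply: kp; exact: subset_closure.
exists p; split=> //; apply: (selfadjointP sa) => f g Hfg.
by rewrite (form0r (ip_sesquilinear ip)) ipC kp ?rmorph0//; exists g.
Qed.

Lemma op_part_exists H h k : selfadjoint ip H -> H (h, k) ->
  exists k', op_part H (h, k') /\ ip k h = ip k' h.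
Proof.
move=> sa Hhk; have [p [Dp Hm kp]] := dom_mul_decomposition k sa.
have Dh : rdom H h by exists k.
exists p; split.
  split; last by split => //=; exact: subset_closure.
  have := linear_relB (selfadjoint_linear sa) Hhk Hm.
  by rewrite subr0 opprB addrC subrK.
by apply/eqP; have := kp h Dh; rewrite !ipE => /eqP; rewrite subr_eq0.
Qed.

End SelfadjointRelations.

(** * Resolvents, ordering and inversion *)

Section Resolvents.
Variables (R : realType) (V : completeNormedModType R[i]).
Variable ip : {dot V for @Num.conj R[i]}.
Hypothesis hip : norm_from_dot ip.
Local Notation C := R[i].
Local Notation sqn := (sqn ip).
Local Notation rel_form := (rel_form ip).
Implicit Types (u v w h k f g : V) (H G : set (V * V)) (K : V -> V).

Let ipE := formE (ip_sesquilinear ip).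

(* The form of [I + t K]. *)
Definition res_form K (t : R) u v : C := ip u v + t%:C * ip (K u) v.

Lemma res_form_diag K t u :
  complex.Re (res_form K t u u) = sqn u + t * complex.Re (ip (K u) u).
Proof. by rewrite /res_form !ReE /= mul0r subr0. Qed.

(** * A nonnegative resolvent [K] and the form of [I + t K] *)

Section Resolvent.
Variables (H : set (V * V)) (x : R) (K : V -> V).
Hypothesis sa : selfadjoint ip H.
Hypothesis HK : forall f, H (K f, f + x%:C *: K f).
Hypothesis K_ge0 : forall f, 0 <= complex.Re (ip (K f) f).

(** [K] is given only as a choice of values of the inverse of [H - x]. Two values at the same point
    differ by some [w] with [{w, x w}] in [H]; symmetry against [{K w, w + x K w}] gives
    [(w,w) = 0]. Linearity of [K] follows from this. *)
Lemma resolvent_unique h k : H (h, k) -> K (k - x%:C *: h) = h.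
Proof.
move=> Hhk; apply/eqP; rewrite -subr_eq0; set f := k - _; apply/eqP.
have := linear_relB (selfadjoint_linear sa) (HK f) Hhk.
have -> : f + x%:C *: K f - k = x%:C *: (K f - h).
  by rewrite scalerBr {1}/f [LHS]addrC !addrA addNr add0r addrC.
move: (K f - h) => w Hw; apply: (sqn_eq0 (ip := ip)).
have := selfadjoint_sym sa (HK w) Hw.
rewrite !ipE conj_real => /eqP; rewrite -subr_eq0 addrK => /eqP ww.
by rewrite /sqn ww.
Qed.

Lemma resolvent_linear a u v : K (a *: u + v) = a *: K u + K v.
Proof.
have [_ HL] := selfadjoint_linear sa.
have := resolvent_unique (HL a _ _ (HK u) (HK v)).
rewrite /= => <-; congr K.
by rewrite !scalerDr !scalerA [x%:C * a]mulrC addrACA addrK.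
Qed.

Lemma resolvent_sym u v : ip (K u) v = ip u (K v).
Proof.
have := selfadjoint_sym sa (HK u) (HK v).
by rewrite !ipE conj_real => /addIr.
Qed.

Lemma res_form_sesquilinear t : sesquilinear_form (res_form K t).
Proof. by split=> a u v w; rewrite /res_form ?resolvent_linear !ipE; ring. Qed.

Lemma res_form_hermitian t S : hermitian_on S (res_form K t).
Proof.
move=> u v _ _; rewrite /res_form rmorphD rmorphM /= conj_real -!ipC.
by rewrite resolvent_sym.
Qed.

Lemma resolvent_form_sesquilinear : sesquilinear_form (fun u v => ip (K u) v).
Proof. by split=> a u v w; rewrite ?resolvent_linear !ipE. Qed.

(* Positivity of [K] at [x h + f], where [f = k - x h]. *)
Lemma res_form_neg h k : H (h, k) -> complex.Re (ip k h) < 0 ->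
  complex.Re (res_form K x h h) < 0.
Proof.
move=> Hhk kh; have := resolvent_unique Hhk.
have [f kE] : exists f, k = f + x%:C *: h by exists (k - x%:C *: h); rewrite subrK.
rewrite {1}kE addrK => Kf.
move: kh; have := K_ge0 f; have := K_ge0 (x%:C *: h + f); have := sqn_ge0 ip h.
rewrite resolvent_linear res_form_diag !ipE Kf conj_real !ReE (resolvent_sym h f) Kf.
rewrite kE !ipE !ReE (ipC _ h f) !ReE -/(sqn h) /=.
move: (sqn h) (complex.Re (ip (K h) h)) (complex.Re (ip h f)) => s r w.
rewrite !mul0r !subr0 => s0 h1 w0 ws.
(* Here [w = (K f, f) >= 0] and [w + x s = (k,h) < 0]. Multiplying the goal by the negative [x]
   turns it into the positivity inequality [x^2 r + 2 x s + w >= 0] combined with [w + x s < 0]. *)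
have x0 : x < 0 by rewrite ltNge; apply/negP => x0; have := mulr_ge0 x0 s0; lra.
by rewrite -(nmulr_rgt0 _ x0); lra.
Qed.

(* [sqn (h + x K h) >= 0]. *)
Lemma rel_form_neg h : complex.Re (res_form K x h h) < 0 ->
  complex.Re (ip (h + x%:C *: K h) (K h)) < 0.
Proof.
have := sqn_ge0 ip (h + x%:C *: K h); have := sqn_ge0 ip h; have := K_ge0 h.
rewrite res_form_diag sqnD sqnZ !ipE conj_real !ReE /=.
rewrite (ipC _ (K h) h) Re_conj -/(sqn (K h)).
rewrite /sqnormc /=.
move: (sqn h) (complex.Re (ip (K h) h)) (sqn (K h)) => s r q.
rewrite !mul0r !subr0 => r0 s0 h1 h2.
have x0 : x < 0 by rewrite ltNge; apply/negP => x0; have := mulr_ge0 x0 r0; lra.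
by rewrite -(nmulr_rgt0 _ x0); lra.
Qed.

(** Negative families are transported by the linear maps [{h,k} |-> h] and [f |-> {K f, f + x K f}].
    Neither map has to preserve the value of the form; preserving its negativity is enough. *)
Lemma negative_dim_resolvent n :
  negative_dim_ge rel_form H n <-> negative_dim_ge (res_form K x) setT n.
Proof.
have lH := selfadjoint_linear sa.
split=> -[v [Sv nv]].
  exists (fun i => (v i).1); split=> // c cn0.
  have Hs := linear_set_sum c lH Sv; have := nv c cn0.
  have -> : \sum_(i < n) c i *: (v i).1 = (\sum_(i < n) c i *: v i).1.
    by rewrite (big_morph fst (id1 := 0) (op1 := +%R)).
  by case: (\sum_(i < n) _) Hs => h k Hhk; exact: res_form_neg.
exists (fun i => (K (v i), v i + x%:C *: K (v i))); split=> // c cn0.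
have KE : K (\sum_(i < n) c i *: v i) = \sum_(i < n) c i *: K (v i).
  have [_ HL] := linear_setT V.
  have K0 : K 0 = 0.
    by have := resolvent_unique lH.1; rewrite scaler0 subr0.
  rewrite (big_morph K (id1 := 0) (op1 := +%R)) ?K0//.
    by apply: eq_bigr => i _; rewrite -[_ *: v i]addr0 resolvent_linear K0 addr0.
  by move=> a b; rewrite -[a]scale1r resolvent_linear !scale1r.
have -> : \sum_(i < n) c i *: (K (v i), v i + x%:C *: K (v i)) =
    (K (\sum_(i < n) c i *: v i),
     \sum_(i < n) c i *: v i + x%:C *: K (\sum_(i < n) c i *: v i)).
  rewrite [LHS]surjective_pairing; congr pair.
    by rewrite KE (big_morph fst (id1 := 0) (op1 := +%R)).
  rewrite KE (big_morph snd (id1 := 0) (op1 := +%R))//= scaler_sumr -big_split.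
  by apply: eq_bigr => i _ /=; rewrite scalerDr !scalerA mulrC.
exact: rel_form_neg (nv c cn0).
Qed.

End Resolvent.

(** * The order, the negative index and inversion *)

Lemma rle_resolvents H1 H2 : rle ip H1 H2 -> exists (x : R) K1 K2,
  [/\ forall f, H1 (K1 f, f + x%:C *: K1 f),
      forall f, H2 (K2 f, f + x%:C *: K2 f),
      forall f, 0 <= complex.Re (ip (K1 f) f),
      forall f, 0 <= complex.Re (ip (K2 f) f) &
      forall f, complex.Re (ip (K2 f) f) <= complex.Re (ip (K1 f) f)].
Proof.
move=> [x [_ [_ /choice[K1 /choice[K2 K12]]]]]; exists x, K1, K2.
have K12' f : 0 <= complex.Re (ip (K2 f) f) <= complex.Re (ip (K1 f) f).
  have [_ [_]] := K12 f; rewrite !lecE => /andP[/andP[_ ->] /andP[_ ->]].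
  by [].
split=> f.
- by have [/resolventE] := K12 f.
- by have [_ [/resolventE]] := K12 f.
- by have /andP[a b] := K12' f; exact: le_trans b.
- by have /andP[] := K12' f.
- by have /andP[] := K12' f.
Qed.

(** For [x < 0], [K2 <= K1] gives [I + x K1 <= I + x K2], so a negative family of the latter is one
    of the former. For [x >= 0] the form of [I + x K2] is nonnegative and only [n = 0] occurs. *)
Lemma rle_negative_dim H1 H2 n :
  selfadjoint ip H1 -> selfadjoint ip H2 -> rle ip H1 H2 ->
  negative_dim_ge rel_form H2 n -> negative_dim_ge rel_form H1 n.
Proof.
move=> sa1 sa2 /rle_resolvents[x [K1 [K2 [HK1 HK2 K1ge0 K2ge0 K12]]]].
have [x0|x0] := lerP 0 x.
  case: n => [_|n]; first exact: negative_dim_ge0.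
  rewrite (negative_dim_resolvent sa2 HK2 K2ge0) => nd; exfalso.
  apply: nonneg_negative_dim (linear_setT _) _ nd => u _.
  by rewrite res_form_diag addr_ge0 ?sqn_ge0 ?mulr_ge0.
rewrite (negative_dim_resolvent sa2 HK2 K2ge0) (negative_dim_resolvent sa1 HK1 K1ge0).
apply: negative_dim_ge_sub (linear_setT _) => u _.
by rewrite !res_form_diag lerD2l ler_nM2l.
Qed.

Lemma rinv_negative_dim H n : selfadjoint ip H ->
  negative_dim_ge rel_form (rinv H) n <-> negative_dim_ge rel_form H n.
Proof.
suff sw G : selfadjoint ip G ->
    negative_dim_ge rel_form G n -> negative_dim_ge rel_form (rinv G) n.
  move=> sa; split; last exact: sw.
  move=> /(sw _ (selfadjoint_rinv sa)) [v [Sv nv]]; exists v; split=> // i.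
  by move: (Sv i); case: (v i) => a b /rinvE/rinvE.
move=> sa [v [Sv nv]]; exists (fun i => ((v i).2, (v i).1)); split.
  by move=> i; apply/rinvE; rewrite -surjective_pairing.
move=> c cn0; have := nv c cn0; rewrite /rel_form.
rewrite !(big_morph fst (id1 := 0) (op1 := +%R))//.
rewrite !(big_morph snd (id1 := 0) (op1 := +%R))//=.
by rewrite (ipC _ (\sum_(i < n) c i *: (v i).1)) Re_conj.
Qed.

(** Finite negative index makes the inverse bounded from below: a maximal orthonormal negative
    family [e] bounds [(k,h)] below by minus the sum of the [|(k, (e i).1)|^2], and Cauchy-Schwarz
    applies to each term. *)
Lemma rinv_lower_bound H n : selfadjoint ip H ->
  negative_dim_ge rel_form H n -> ~ negative_dim_ge rel_form H n.+1 ->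
  exists2 c : R, 0 <= c & forall h k, H (h, k) -> - c * sqn k <= complex.Re (ip k h).
Proof.
move=> sa nH nmax.
have sB := rel_form_sesquilinear ip; have hB := selfadjoint_hermitian sa.
have lH := selfadjoint_linear sa.
have [e eo] := neg_orthonormal_exists sB hB lH nH.
exists (\sum_(i < n) sqn (e i).1); first by apply: sumr_ge0 => i _; exact: sqn_ge0.
move=> h k Hhk; apply: le_trans (neg_orthonormal_maximal sB hB lH eo nmax Hhk).
rewrite mulNr lerN2 mulr_suml; apply: ler_sum => i _.
by rewrite mulrC; exact: cauchy_schwarz.
Qed.

Lemma selfadjoint_form_real H h k : selfadjoint ip H -> H (h, k) ->
  ip k h = (complex.Re (ip k h))%:C.
Proof. by move=> sa Hhk; exact: (hermitian_diag_real (selfadjoint_hermitian sa) Hhk). Qed.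

Lemma lt_lower_bound G (m y : R) : selfadjoint ip G ->
  (forall h k, G (h, k) -> m * sqn h <= complex.Re (ip k h)) -> y < m ->
  (y%:E < lower_bound ip G)%E.
Proof.
move=> sa lb ym; apply: (@lt_le_trans _ _ m%:E); first by rewrite lte_fin.
apply: ereal_sup_ubound; exists m => // h k [Ghk _].
by rewrite (selfadjoint_form_real sa Ghk) ip_sqn -rmorphM lecR; exact: lb.
Qed.

(** [(f,g) = (f + y g, g) - y (g,g)], which is real and at least [(m - y) (g,g)]. *)
Lemma resolvent_form_ge0 G (m y : R) f g : selfadjoint ip G ->
  (forall h k, G (h, k) -> m * sqn h <= complex.Re (ip k h)) -> y < m ->
  G (g, f + y%:C *: g) ->
  ip g f = (complex.Re (ip g f))%:C /\ 0 <= complex.Re (ip g f).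
Proof.
move=> sa lb ym Gg; have := selfadjoint_form_real sa Gg.
have := lb _ _ Gg; rewrite !ipE ip_sqn !ReE /= mul0r subr0 => gm.
rewrite rmorphD /= -rmorphM => /addIr fg; split.
  by rewrite (ipC _ f g) fg conj_real.
rewrite (ipC _ f g) Re_conj; have := sqn_ge0 ip g; nra.
Qed.

Lemma rinv_antitone H1 H2 n :
  selfadjoint ip H1 -> selfadjoint ip H2 -> rle ip H1 H2 ->
  negative_dim_ge rel_form H1 n -> ~ negative_dim_ge rel_form H1 n.+1 ->
  negative_dim_ge rel_form H2 n -> ~ negative_dim_ge rel_form H2 n.+1 ->
  rle ip (rinv H2) (rinv H1).
Proof.
move=> sa1 sa2 /rle_resolvents[x [K1 [K2 [HK1 HK2 K1ge0 K2ge0 K12]]]] n1 m1 n2 m2.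
have [c1 c10 lb1] := rinv_lower_bound sa1 n1 m1.
have [c2 c20 lb2] := rinv_lower_bound sa2 n2 m2.
have {}lb1 h k : rinv H1 (h, k) -> - c1 * sqn h <= complex.Re (ip k h).
  by move=> /rinvE /lb1; rewrite ipC Re_conj.
have {}lb2 h k : rinv H2 (h, k) -> - c2 * sqn h <= complex.Re (ip k h).
  by move=> /rinvE /lb2; rewrite ipC Re_conj.
have sr1 := selfadjoint_rinv sa1; have sr2 := selfadjoint_rinv sa2.
(* [I + (x + eps) K2] is the perturbation of [I + x K2] by [eps K2], so for small [eps] it keeps [n]
   negative directions. *)
have [a a0 stab] : exists2 a : R, 0 < a & x < 0 -> forall eps, 0 <= eps -> eps < a ->
    negative_dim_ge (res_form K2 (x + eps)) setT n.
  have sB := res_form_sesquilinear sa2 HK2 x.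
  have hB := @res_form_hermitian _ _ _ sa2 HK2 x setT.
  move: n2; rewrite (negative_dim_resolvent sa2 HK2 K2ge0).
  move=> /(neg_orthonormal_exists sB hB (linear_setT _))[e eo].
  have [a a0 aP] := neg_orthonormal_stable sB (resolvent_form_sesquilinear sa2 HK2) eo.
  exists a => // _ eps e0 ea; apply: negative_dim_ge_sub (linear_setT _) _; last first.
    by exists e; exact: (aP eps).
  by move=> u _ /=; rewrite /res_form !ReE /= !mul0r !subr0; lra.
(* The three bounds serve, in order, to keep the negative family of [K2], to keep [x + eps] negative
   when [x] is, and to place [- 1/eps] below both lower bounds [- c1] and [- c2]. *)
pose eps := Num.min (Num.min (a / 2) (if x < 0 then - x / 2 else 1)) (c1 + c2 + 1)^-1.
have eps0 : 0 < eps.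
  rewrite !lt_min divr_gt0//= invr_gt0; apply/andP; split; last lra.
  by case: ifPn => // x0; lra.
have eps_a : eps < a.
  have : eps <= a / 2 by rewrite !ge_min lexx.
  lra.
have eps_x : x < 0 -> x + eps < 0.
  move=> x0; have : eps <= - x / 2 by rewrite !ge_min x0 lexx orbT.
  lra.
have eps_c : eps * (c1 + c2 + 1) <= 1.
  by rewrite -ler_pdivlMr ?div1r ?ge_min ?lexx ?orbT//; lra.
(* With [y = - 1/eps], the resolvents of [H_j^-1] at [y] and of [H_j] at [- eps]
   are related, and [H_j + eps] is encoded by [I + (x + eps) K_j]. *)
pose y := - eps^-1.
have epsy : eps * y = -1 by rewrite /y mulrN divff ?gt_eqF.
have [y1 y2] : y < - c1 /\ y < - c2 by split; nra.
clearbody eps y.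
exists y; split; first exact: lt_lower_bound sr2 lb2 y2.
split; first exact: lt_lower_bound sr1 lb1 y1.
move=> f.
have [g1 Gg1] := resolvent_surjective hip sr1 lb1 y1 f.
have [g2 Gg2] := resolvent_surjective hip sr2 lb2 y2 f.
exists g2, g1; split; first exact/resolventE.
split; first exact/resolventE.
have [r1 p1] := resolvent_form_ge0 sr1 lb1 y1 Gg1.
have [r2 p2] := resolvent_form_ge0 sr2 lb2 y2 Gg2.
rewrite r1 r2 ler0c lecR p1 /=.
(* [{u_j, g_j}] lies in [H_j], so [u_j] is the value of [K_j] at [s_j = g_j - x u_j]. *)
pose u1 := f + y%:C *: g1; pose u2 := f + y%:C *: g2.
pose s1 := g1 - x%:C *: u1; pose s2 := g2 - x%:C *: u2.
have Ks1 : K1 s1 = u1 by apply: (resolvent_unique sa1 HK1); exact/rinvE.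
have Ks2 : K2 s2 = u2 by apply: (resolvent_unique sa2 HK2); exact/rinvE.
pose t := x + eps.
have epsyC : eps%:C * y%:C = -1 :> C by rewrite -rmorphM epsy rmorphN1.
(* [s1 + (x + eps) u1 = g1 + eps u1 = eps f], because [eps * y = -1]. The same holds with index 2,
   so both forms represent the functional of [eps f]. *)
have bs1 z : res_form K1 t s1 z = eps%:C * ip f z.
  rewrite /res_form Ks1 /s1 /u1 !ipE rmorphD/=.
  transitivity (eps%:C * ip f z + (eps%:C * y%:C + 1) * ip g1 z); first by ring.
  by rewrite epsyC addNr mul0r addr0.
have bs2 z : res_form K2 t s2 z = eps%:C * ip f z.
  rewrite /res_form Ks2 /s2 /u2 !ipE rmorphD/=.
  transitivity (eps%:C * ip f z + (eps%:C * y%:C + 1) * ip g2 z); first by ring.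
  by rewrite epsyC addNr mul0r addr0.
(* Taking [(s1, f)] gives [(1 - x y) (g1, f) - x (f,f)], and [eps (1 - x y) = t]. Comparing the
   [(g_j, f)] thus reduces to comparing the [(s_j, f)], in reversed order when [t < 0]. *)
have gs1 : t * complex.Re (ip g1 f) = eps * (complex.Re (ip s1 f) + x * sqn f).
  rewrite /s1 /u1 !ipE !ReE /= -/(sqn f) /t.
  move: (complex.Re (ip g1 f)) => G.
  transitivity (eps * G - x * (eps * y) * G); first by rewrite epsy; ring.
  by ring.
have gs2 : t * complex.Re (ip g2 f) = eps * (complex.Re (ip s2 f) + x * sqn f).
  rewrite /s2 /u2 !ipE !ReE /= -/(sqn f) /t.
  move: (complex.Re (ip g2 f)) => G.
  transitivity (eps * G - x * (eps * y) * G); first by rewrite epsy; ring.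
  by ring.
have d1 : complex.Re (res_form K1 t s1 s1) = eps * complex.Re (ip s1 f).
  by rewrite bs1 ReM /= mul0r subr0 (ipC _ s1 f) Re_conj.
have d2 : complex.Re (res_form K2 t s2 s2) = eps * complex.Re (ip s2 f).
  by rewrite bs2 ReM /= mul0r subr0 (ipC _ s2 f) Re_conj.
have sB1 := res_form_sesquilinear sa1 HK1 t.
have sB2 := res_form_sesquilinear sa2 HK2 t.
have hB1 := @res_form_hermitian _ _ _ sa1 HK1 t setT.
have hB2 := @res_form_hermitian _ _ _ sa2 HK2 t setT.
have [x0|x0] := ltrP x 0.
  have t0 : t < 0 by exact: eps_x.
  have : complex.Re (res_form K2 t s2 s2) <= complex.Re (res_form K1 t s1 s1).
    apply: (@inverse_form_antitone _ _ _ _ n) => //.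
    - by move=> u; rewrite !res_form_diag lerD2l ler_nM2l.
    - by move=> z; rewrite bs1 bs2.
    - by apply: stab => //; exact: ltW.
    (* [eps K1 >= 0], so passing from [x] to [t] cannot raise the negative index. *)
    - apply: contra_not m1; rewrite (negative_dim_resolvent sa1 HK1 K1ge0).
      apply: negative_dim_ge_sub (linear_setT _) => u _.
      by rewrite !res_form_diag lerD2l ler_wpM2r// /t lerDl ltW.
  by rewrite d1 d2 => ss; rewrite -(ler_nM2l t0) gs1 gs2 !mulrDr lerD2r.
(* Now [I + t K2 <= I + t K1] and both are nonnegative: the comparison applies with index 0 and the
   roles of the forms exchanged. *)
have t0 : 0 < t by rewrite /t; lra.
have : complex.Re (res_form K1 t s1 s1) <= complex.Re (res_form K2 t s2 s2).
  apply: (@inverse_form_antitone _ _ _ _ 0) => //.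
  - by move=> u; rewrite !res_form_diag lerD2l ler_pM2l.
  - by move=> z; rewrite bs1 bs2.
  - exact: negative_dim_ge0.
  - apply: nonneg_negative_dim (linear_setT _) _ => u _.
    by rewrite res_form_diag addr_ge0 ?sqn_ge0// mulr_ge0// ltW.
by rewrite d1 d2 => ss; rewrite -(ler_pM2l t0) gs1 gs2 !mulrDr lerD2r.
Qed.

End Resolvents.

(** * Spectral measures *)

Section MeasureLemmas.
Variables (d : measure_display) (T : measurableType d) (R : realType).
Variable mu : {measure set T -> \bar R}.

Lemma integrable_of_bounded_off_null (f : T -> R) (A : set T) :
  measurable A -> mu (~` A) = 0 -> (mu A < +oo)%E ->
  measurable_fun setT f -> [bounded f x | x in A] ->
  mu.-integrable setT (EFin \o f).
Proof.
move=> mA nA fA mf bf.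
have mAC : measurable (~` A) by exact: measurableC.
apply/(negligible_integrable mAC) => //; first exact/measurable_EFinP.
rewrite setTD setCK; apply: measurable_bounded_integrable => //.
exact: measurable_funS mf.
Qed.

Lemma Rintegral_null_set (f : T -> R) (A : set T) :
  measurable A -> mu (~` A) = 0 -> mu.-integrable setT (EFin \o f) ->
  \int[mu]_t f t = \int[mu]_(t in A) f t.
Proof.
move=> mA nA fi; rewrite /Rintegral (negligible_integral (measurableC mA))//.
by rewrite setTD setCK.
Qed.

(** A vanishing integral would make the positive [f] zero almost everywhere on [A], hence [A]
    null. *)
Lemma Rintegral_gt0 (f : T -> R) (A : set T) :
  measurable A -> mu (~` A) = 0 -> mu A != 0 -> mu.-integrable setT (EFin \o f) ->
  (forall t, A t -> 0 < f t) -> 0 < \int[mu]_t f t.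
Proof.
move=> mA nA Apos fi f0; rewrite (Rintegral_null_set mA)//.
have fiA : mu.-integrable A (EFin \o f) by apply: integrableS fi.
have int_ge0 : (0 <= \int[mu]_(t in A) (f t)%:E)%E.
  by apply: integral_ge0 => t At; rewrite lee_fin ltW// f0.
rewrite lt_neqAle fine_ge0// andbT eq_sym; apply: contra Apos.
rewrite fine_eq0 ?integrable_fin_num// => /eqP intf0; apply/eqP.
have : ae_eq mu A (EFin \o f) (cst 0).
  apply/ae_eq_integral_abs => //; first exact: measurable_int fiA.
  rewrite -intf0; apply: eq_integral => t; rewrite inE => At /=.
  by rewrite ger0_norm// ltW// f0.
move=> [N [mN N0 sub]]; apply: (subset_measure0 mA mN) N0 => t At.
by apply: sub => /= /(_ At) [ft0]; have := f0 t At; rewrite ft0 ltxx.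
Qed.

End MeasureLemmas.

(** * First and second moments of measures on the line *)

Section MeasureLine.
Variable R : realType.
Variable mu : {measure set (measurableTypeR R) -> \bar R}.

(** The negative part of the identity vanishes off a null set. If the integral of the positive part
    is infinite, [fine] returns 0 and the inequality still holds. *)
Lemma Rintegral_id_ge0 : mu `]-oo, 0[%classic = 0 -> 0 <= \int[mu]_t t.
Proof.
move=> mu0; rewrite /Rintegral fine_ge0// integralE.
have -> : (\int[mu]_x ((EFin : R -> \bar R)^\- x) = 0)%E.
  rewrite (@ge0_negligible_integral _ (measurableTypeR R) _ _ _ `]-oo, 0[%classic)//.
    apply: integral0_eq => t [_ /= /negP]; rewrite in_itv/= -leNgt => t0.
    by rewrite funenegE -EFinN -EFin_max; congr EFin; apply/max_idPr; rewrite oppr_le0.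
  by apply: measurable_funeneg; exact/measurable_EFinP.
by rewrite sube0 integral_ge0.
Qed.

Variables a b : R.
Hypothesis mu_off : mu (~` `]a, b[%classic) = 0.
Hypothesis mu_fin : (mu `]a, b[%classic < +oo)%E.

Lemma integrable_off_itv (f : R -> R) (M : R) : measurable_fun setT f ->
  (forall t, a < t -> t < b -> `|f t| <= M) -> mu.-integrable setT (EFin \o f).
Proof.
move=> mf fM; apply: (@integrable_of_bounded_off_null _ (measurableTypeR R) _ _ _ `]a, b[%classic) => //.
exists M; split; first exact: num_real.
move=> y My t /=; rewrite in_itv/= => /andP[at_ tb].
exact: le_trans (fM t at_ tb) (ltW My).
Qed.

Lemma integrable_id_off_itv : mu.-integrable setT (fun t : R => t%:E).
Proof.
apply: (@integrable_off_itv id (`|a| + `|b|)) => // t at_ tb.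
have := ler_norm b; have := ler_norm (- a); rewrite normrN.
have := normr_ge0 a; have := normr_ge0 b.
by move=> *; rewrite ler_norml; apply/andP; split; lra.
Qed.

Lemma second_moment_off_itv : (\int[mu]_t (t ^+ 2)%:E < +oo)%E.
Proof.
have /integrableP[_] : mu.-integrable setT (fun t : R => (t ^+ 2)%:E).
  apply: (@integrable_off_itv (fun t => t ^+ 2) ((`|a| + `|b|) ^+ 2)) => //.
  move=> t at_ tb; rewrite normrX lerXn2r ?nnegrE ?addr_ge0//.
  have := ler_norm b; have := ler_norm (- a); rewrite normrN.
  have := normr_ge0 a; have := normr_ge0 b.
  by move=> *; rewrite ler_norml; apply/andP; split; lra.
by under eq_integral do rewrite gee0_abs ?lee_fin ?sqr_ge0//.
Qed.

Lemma Rintegral_id_lt : mu `]a, b[%classic != 0 ->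
  \int[mu]_t t < b * fine (mu `]a, b[%classic).
Proof.
move=> mu0.
have ii := integrable_id_off_itv.
have ib : mu.-integrable setT (fun=> b%:E).
  by apply: (@integrable_off_itv (fun=> b) `|b|).
have := @Rintegral_gt0 _ (measurableTypeR R) _ mu (fun t => b - t) `]a, b[%classic.
rewrite RintegralB// (@Rintegral_null_set _ (measurableTypeR R) _ _ (fun=> b) `]a, b[%classic)//.
rewrite Rintegral_cst// subr_gt0; apply => //.
  apply: (@integrable_off_itv _ (b - a)); first exact: measurable_funB.
  by move=> t at_ tb; rewrite ger0_norm; lra.
by move=> t /=; rewrite in_itv/= subr_gt0 => /andP[].
Qed.

End MeasureLine.

(** * The spectral subspace of the negative half-line *)

Section SpectralMeasure.
Variables (R : realType) (V : completeNormedModType R[i]).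
Variable ip : {dot V for @Num.conj R[i]}.
Hypothesis hip : norm_from_dot ip.
Local Notation sqn := (sqn ip).
Local Notation rel_form := (rel_form ip).
Implicit Types (u v w h k f g : V).

Section Projections.
Variables (E : set R -> {linear V -> V}).
Variable mu : V -> {measure set (measurableTypeR R) -> \bar R}.
Hypothesis pvm : projection_valued_measure ip E mu.
Implicit Types A B : set (measurableTypeR R).

Lemma pvm_measure A v : measurable A -> mu v A = (sqn (E A v))%:E.
Proof.
by move=> mA; rewrite (pvm_scalar pvm)// -{1}(pvm_idem pvm)// (pvm_sym pvm).
Qed.

Lemma pvm_measure0 A v : measurable A -> mu v A = 0 <-> E A v = 0.
Proof.
move=> mA; rewrite pvm_measure//; split=> [[]/(@sqn_eq0 _ _ ip)//|->].
by rewrite sqn0.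
Qed.

Lemma pvm_disjoint A B v : measurable A -> measurable B -> A `&` B = set0 ->
  E A (E B v) = 0.
Proof.
move=> mA mB AB; rewrite -(pvm_inter pvm)// AB.
by apply/pvm_measure0; rewrite ?measure0.
Qed.

Lemma pvm_subset A B v : measurable A -> measurable B -> A `<=` B ->
  E B (E A v) = E A v.
Proof. by move=> mA mB AB; rewrite -(pvm_inter pvm)// setIidr. Qed.

End Projections.

Variables (H : set (V * V)) (E : set R -> {linear V -> V}).
Variable mu : V -> {measure set (measurableTypeR R) -> \bar R}.
Hypothesis sa : selfadjoint ip H.
Hypothesis pvm : projection_valued_measure ip E mu.
Hypothesis E_dom : forall h, closure (rdom H) h -> E setT h = h.
Hypothesis E_mul : forall h, rmul H h -> E setT h = 0.
Hypothesis domE : forall h, rdom H h <->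
  closure (rdom H) h /\ (\int[mu h]_t (t ^+ 2)%:E < +oo)%E.
Hypothesis op_form : forall h k, op_part H (h, k) -> ip k h = (\int[mu h]_t t)%:C.

Lemma pvm_range_dom v : E setT v = v -> closure (rdom H) v.
Proof.
move=> Ev; have [p [Dp /E_mul + _]] := dom_mul_decomposition hip v sa.
by rewrite linearB Ev (E_dom Dp) => /subr0_eq ->.
Qed.

Lemma form_nonneg_of_null h k : H (h, k) -> E `]-oo, 0[%classic h = 0 ->
  0 <= complex.Re (ip k h).
Proof.
move=> Hhk Eh; have [k' [Hk' ->]] := op_part_exists hip sa Hhk.
rewrite (op_form Hk') /=; apply: Rintegral_id_ge0.
by apply/(pvm_measure0 pvm).
Qed.

(** Concentration on a bounded interval makes the second moment finite, which puts [v] in the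
    domain; the form is then the integral of [t < b] against a measure of total mass [sqn v]. *)
Lemma form_lt_of_concentrated (a b : R) v : E setT v = v ->
  mu v (~` `]a, b[%classic) = 0 ->
  exists k, op_part H (v, k) /\ (v != 0 -> complex.Re (ip k v) < b * sqn v).
Proof.
move=> Ev off.
have mI : measurable (`]a, b[%classic : set (measurableTypeR R)).
  exact: measurable_itv.
have muI : mu v `]a, b[%classic = (sqn v)%:E.
  rewrite -[in RHS]Ev -(pvm_measure pvm)//.
  rewrite -[in RHS](setvU `]a, b[%classic) measureU ?setICl//; last exact: measurableC.
  by rewrite [X in (X + _)%E]off add0e.
have fin : (mu v `]a, b[%classic < +oo)%E by rewrite muI ltry.
have Dv : rdom H v.
  by apply/domE; split; [exact: pvm_range_dom|exact: (second_moment_off_itv off)].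
have [k0 Hk0] := Dv; have [k [Hk _]] := op_part_exists hip sa Hk0.
exists k; split=> // v0; rewrite (op_form Hk) /=.
have -> : sqn v = fine (mu v `]a, b[%classic) by rewrite muI.
apply: (Rintegral_id_lt off) => //; rewrite muI; apply: contra_neq v0 => -[].
exact: sqn_eq0.
Qed.

Variable m : R.
Hypothesis H_m : bounded_below_by ip H m.

(** A nonzero vector in the range of [E] on []a, m[] would have form value below [m * sqn]. Bounded
    intervals are treated first so that such vectors lie in the domain; countably many of them
    exhaust the half-line. *)
Lemma pvm_below_null v : E `]-oo, m[%classic v = 0.
Proof.
have mI (a : R) : measurable (`]a, m[%classic : set (measurableTypeR R)).
  exact: measurable_itv.
have null (a : R) : mu v `]a, m[%classic = 0.
  apply/(pvm_measure0 pvm) => //; set w := E _ v.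
  have Ew : E setT w = w by exact: (pvm_subset pvm).
  have off : mu w (~` `]a, m[%classic) = 0.
    apply/(pvm_measure0 pvm); first exact: measurableC.
    by apply: (pvm_disjoint pvm) => //; [exact: measurableC|exact: setICl].
  have [k [Hk kw]] := form_lt_of_concentrated Ew off.
  apply/eqP/negPn/negP => /kw; apply/negP; rewrite -leNgt.
  by have := H_m Hk; rewrite lecE ip_sqn -rmorphM => /andP[].
apply/(pvm_measure0 pvm) => //.
have -> : `]-oo, m[%classic = \bigcup_n `]m - n.+1%:R, m[%classic :> set R.
  apply/seteqP; split=> t /=.
    rewrite in_itv/= => tm; exists (Num.bound (m - t)) => //=.
    rewrite in_itv/= tm andbT.
    have := archi_boundP (x := m - t); rewrite subr_ge0 => /(_ (ltW tm)).
    by rewrite -natr1; lra.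
  by case=> n _ /=; rewrite !in_itv/= => /andP[].
apply: measure_negligible; first by apply: bigcup_measurable => n _; exact: mI.
by apply: negligible_bigcup => n; apply/negligibleP; [exact: mI|exact: null].
Qed.

Lemma form_neg_of_range v : range (E `]-oo, 0[%classic) v ->
  exists k, H (v, k) /\ (v != 0 -> complex.Re (ip k v) < 0).
Proof.
move=> [w _ wv].
have mI (i : interval R) : measurable ([set` i] : set (measurableTypeR R)).
  exact: measurable_itv.
have Ev : E setT v = v by rewrite -wv; exact: (pvm_subset pvm).
(* Any point below [m] would confine [v] to []a, 0[]: what lies to the left of it is in the null
   half-line []-oo, m[]. *)
pose a := Num.min m 0 - 1.
have off : mu v (~` `]a, 0[%classic) = 0.
  have -> : ~` `]a, 0[%classic = `]-oo, a] `|` `[0, +oo[ :> set R.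
    apply/seteqP; split=> t /=; rewrite !in_itv/= ?andbT.
      by move=> /negP; rewrite negb_and -!leNgt => /orP.
    by move=> h; apply/negP; rewrite negb_and -!leNgt; apply/orP.
  apply: measure_negligible; first by apply: measurableU; exact: mI.
  apply: negligibleU; apply/negligibleP; rewrite ?mI//.
    apply: (@subset_measure0 _ (measurableTypeR R) _ _ _ `]-oo, m[%classic); rewrite ?mI//.
      move=> t /=; rewrite !in_itv/= => ta.
      have : Num.min m 0 <= m by rewrite ge_min lexx.
      by rewrite /a in ta; lra.
    by apply/(pvm_measure0 pvm); rewrite ?mI//; exact: pvm_below_null.
  apply/(pvm_measure0 pvm); rewrite ?mI// -wv.
  apply: (pvm_disjoint pvm); rewrite ?mI//.
  by apply/seteqP; split=> // t [] /=; rewrite !in_itv/= andbT leNgt => /negP.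
have [k [[Hk _] kv]] := form_lt_of_concentrated Ev off.
by exists k; split=> // v0; have := kv v0; rewrite mul0r.
Qed.

(** Independent vectors of the spectral subspace lift to a negative family in [H]. Conversely the
    projections of the first components of a negative family are independent: a combination
    projecting to zero would have nonnegative form value. *)
Lemma negative_dim_range n :
  (exists v : 'I_n -> V, (forall i, range (E `]-oo, 0[%classic) (v i)) /\ lin_indep v)
  <-> negative_dim_ge rel_form H n.
Proof.
split=> [[v [rv iv]]|[v [Hv nv]]].
  have /choice[k kP] i : exists k, H (v i, k).
    by have [k []] := form_neg_of_range (rv i); exists k.
  exists (fun i => (v i, k i)); split=> // c [i ci].
  have := linear_set_sum (v := fun i => (v i, k i)) c (selfadjoint_linear sa) kP.
  set p := \sum_(i < n) _.
  have p1 : p.1 = \sum_(i < n) c i *: v i.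
    by rewrite /p (big_morph fst (id1 := 0) (op1 := +%R)).
  have p0 : p.1 != 0.
    apply: contra ci => /eqP; rewrite p1 => /iv/(_ i) ->; exact: eqxx.
  have [k' [Hk' k'p]] : exists k, H (p.1, k) /\ (p.1 != 0 -> complex.Re (ip k p.1) < 0).
    apply: form_neg_of_range; rewrite p1.
    have /choice[w wP] j : exists w, E `]-oo, 0[%classic w = v j.
      by have [w _ wv] := rv j; exists w.
    exists (\sum_(i < n) c i *: w i) => //; rewrite linear_sum.
    by apply: eq_bigr => j _; rewrite linearZ wP.
  rewrite /rel_form; case: p Hk' k'p p0 {p1} => h kk /= Hk' k'p p0 Hp.
  (* The second components [kk] and [k'] over the same [h] differ by an element of [rmul H], which
     is orthogonal to the domain, so the form value is the same. *)
  have := linear_relB (selfadjoint_linear sa) Hp Hk'; rewrite subrr => Hm.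
  have := selfadjoint_sym sa Hm Hp; rewrite (form0l (ip_sesquilinear ip)).
  rewrite (formDl (ip_sesquilinear ip)) (formNl (ip_sesquilinear ip)) => /subr0_eq ->.
  exact: k'p.
exists (fun i => E `]-oo, 0[%classic (v i).1); split; first by move=> i; exists (v i).1.
move=> c c0 i; apply/eqP/negPn/negP => ci.
have := nv c (ex_intro _ i ci); have := linear_set_sum c (selfadjoint_linear sa) Hv.
have : E `]-oo, 0[%classic (\sum_(i < n) c i *: v i).1 = 0.
  rewrite (big_morph fst (id1 := 0) (op1 := +%R))// linear_sum -[RHS]c0.
  by apply: eq_bigr => j _; rewrite linearZ.
case: (\sum_(i < n) _) => h k /= Eh Hhk; apply/negP; rewrite -leNgt.
exact: form_nonneg_of_null.
Qed.

End SpectralMeasure.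

(** * Negative inertia as a supremum, and the equivalence *)

Lemma inertia_neg_sup (R : realType) (V : completeNormedModType R[i])
    (ip : {dot V for @Num.conj R[i]}) (H : set (V * V)) (i : inertia_quad R) :
  norm_from_dot ip -> selfadjoint ip H -> bounded_below ip H -> has_inertia ip H i ->
  inertia_neg i =
    ereal_sup [set n%:R%:E | n in [set n : nat | negative_dim_ge (rel_form ip) H n]].
Proof.
move=> hip sa [m H_m] [E [[mu [pvm Edom Emul domE opE]] ->]] /=; rewrite /subspace_dim.
congr (ereal_sup (image _ _)); apply/seteqP; split=> n /=.
  by move/(negative_dim_range hip sa pvm Edom Emul domE opE H_m).
by move/(negative_dim_range hip sa pvm Edom Emul domE opE H_m).
Qed.

(** A finite supremum of naturals is attained; this turns finite inertia into an exact index [n]. *)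
Lemma ereal_sup_nat_max (R : realType) (Q : set nat) : Q 0%N ->
  (ereal_sup [set (n%:R : R)%:E | n in Q] < +oo)%E ->
  exists n, [/\ Q n, forall j, Q j -> (j <= n)%N &
    ereal_sup [set (n%:R : R)%:E | n in Q] = n%:R%:E].
Proof.
move=> Q0; set s := ereal_sup _ => s_fin.
have ub j : Q j -> (j%:R%:E <= s)%E by move=> Qj; apply: ereal_sup_ubound; exists j.
have s0 := ub _ Q0; have /fineK sE : s \is a fin_num by rewrite ge0_fin_numE.
have exQ : exists j, `[< Q j >] by exists 0%N; exact/asboolP.
have bd j : `[< Q j >] -> (j <= Num.bound (fine s))%N.
  move=> /asboolP/ub; rewrite -sE lee_fin => js; rewrite -(ler_nat R).
  apply: le_trans js (ltW (archi_boundP _)); exact: fine_ge0.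
case: (ex_maxnP exQ bd) => n /asboolP Qn nmax.
have nQ j : Q j -> (j <= n)%N by move=> Qj; apply: nmax; exact/asboolP.
exists n; split=> //; apply/eqP; rewrite eq_le ub// andbT.
by apply: ub_ereal_sup => _ [j Qj <-]; rewrite lee_fin ler_nat nQ.
Qed.

Theorem theorem3p4 (R : realType) (V : completeNormedModType R[i])
    (ip : {dot V for @Num.conj R[i]}) (hip : norm_from_dot ip)
    (hsep : separable_space V)
    (H1 H2 : set (V * V))
    (sa1 : selfadjoint ip H1) (sa2 : selfadjoint ip H2)
    (bb1 : bounded_below ip H1) (bb2 : bounded_below ip H2)
    (i1 i2 : inertia_quad R)
    (hi1 : has_inertia ip H1 i1) (hi2 : has_inertia ip H2 i2)
    (fin1 : (inertia_neg i1 < +oo)%E)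
    (le12 : rle ip H1 H2) :
  rle ip (rinv H2) (rinv H1) <-> inertia_neg i1 = inertia_neg i2.
Proof.
have e1 := inertia_neg_sup hip sa1 bb1 hi1.
have e2 := inertia_neg_sup hip sa2 bb2 hi2.
split=> [le21|e12].
  rewrite e1 e2; congr (ereal_sup (image _ _)); apply/seteqP; split=> n /=.
    move=> /(rinv_negative_dim n sa1).
    move/(rle_negative_dim (selfadjoint_rinv sa2) (selfadjoint_rinv sa1) le21).
    by move/(rinv_negative_dim n sa2).
  exact: rle_negative_dim.
have fin2 := fin1; rewrite e12 e2 in fin2; rewrite e1 in fin1.
have [n1 [Q1 max1 s1]] := ereal_sup_nat_max (negative_dim_ge0 _ _) fin1.
have [n2 [Q2 max2 s2]] := ereal_sup_nat_max (negative_dim_ge0 _ _) fin2.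
have /eqP : (n1%:R%:E : \bar R) = n2%:R%:E by rewrite -s1 -s2 -e1 -e2.
rewrite eqe eqr_nat => /eqP n12; rewrite -n12 in Q2 max2.
apply: (rinv_antitone hip sa1 sa2 le12 Q1 _ Q2).
  by move=> /max1; rewrite ltnn.
by move=> /max2; rewrite ltnn.
Qed.
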